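(* Let $b>0$, let $q:[0,b]\to\mathbb{C}$ be continuous, let $f$ be a non-vanishing solution of $f''-qf=0$ on $[0,b]$ with $f(0)=1$, $h:=f'(0)$, and let $\beta_n$, $\gamma_n$ ($n\ge0$) be the functions defined in the context. Put additionally $$\beta_{-1}:=\frac12,\qquad \gamma_{-1}(x):=\frac14\int_0^xq(s)\,ds,$$ and $\sigma_n(x):=x^n\beta_n(x)$, $\tau_n(x):=x^n\gamma_n(x)$ for $n\ge-1$. Then the functions $\sigma_n$ satisfy, for $n=1,2,\ldots$, the sequence of recurrent differential equations $$\frac1{2n+1}\bigl(\sigma_n''(x)-q(x)\sigma_n(x)\bigr)=\frac{x^2}{2n-3}\bigl(\sigma_{n-2}''(x)-q(x)\sigma_{n-2}(x)\bigr)-2x\left(\sigma_{n-2}'(x)-\frac{n-1}{x}\sigma_{n-2}(x)\right)$$ with the initial conditions $\sigma_n(0)=\sigma_n'(0)=0$ and with the first functions given by $\beta_{-1}=1/2$ and $\beta_0=(f-1)/2$. The functions $\tau_n$ are given, for $n=1,2,\ldots$, by the sequence of recurrent relations $$\tau_n(x)=\sigma_n'(x)+\frac{2n+1}{2n-3}x^2\bigl(\tau_{n-2}(x)-\sigma_{n-2}'(x)\bigr)+(2n+1)x\,\sigma_{n-2}(x)$$ with the first functions given by $\gamma_{-1}=\frac14\int_0^xq(s)\,ds$ and $\gamma_0=\frac{f'-h}{2}-\frac14\int_0^xq(s)\,ds$.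
   Context: $P_n(x)=\sum_{k=0}^nl_{k,n}x^k$ is the Legendre polynomial of degree $n$, and $p_{j,k}:=\int_{-1}^1P_j(y)y^k\,dy$. Formal powers: $X^{(0)}\equiv\widetilde X^{(0)}\equiv1$ and, for $n\ge1$, $$X^{(n)}(x)=n\int_0^xX^{(n-1)}(s)\,(f^2(s))^{(-1)^n}ds,\qquad \widetilde X^{(n)}(x)=n\int_0^x\widetilde X^{(n-1)}(s)\,(f^2(s))^{(-1)^{n-1}}ds;$$ $\varphi_k=fX^{(k)}$ for odd $k$ and $\varphi_k=f\widetilde X^{(k)}$ for even $k$. Coefficients $\beta_n$, for $x\in(0,b]$ (extended to $x=0$ by continuity): $$\beta_0(x)=\frac{f(x)-1}{2},\qquad \beta_1(x)=\frac32\left(\frac{\varphi_1(x)}{x}-1\right),\qquad \beta_k(x)=\frac1{p_{k,k}}\Bigl(\frac{\varphi_k(x)}{x^k}-1-\sum_{j}p_{j,k}\beta_j(x)\Bigr)\ (k\ge2),$$ where the sum runs over all $j$ with $0\le j\le k-2$ having the same parity as $k$. Coefficients $\gamma_n$, for $x\in(0,b]$ (extended to $x=0$ by continuity), $n\ge0$: $$\gamma_n(x)=\frac{2n+1}{2}\left(\sum_{k=0}^n\frac{l_{k,n}\varphi_k'(x)}{x^k}-\frac{n(n+1)}{2x}-\frac12\int_0^xq(s)\,ds-\frac h2\bigl(1+(-1)^n\bigr)\right).$$ These are the coefficients of the spherical Bessel series $c(\omega,x)=\cos\omega x+2\sum_{n\ge0}(-1)^n\beta_{2n}(x)j_{2n}(\omega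 x)$, $s(\omega,x)=\sin\omega x+2\sum_{n\ge0}(-1)^n\beta_{2n+1}(x)j_{2n+1}(\omega x)$ for solutions of $-y''+qy=\omega^2y$ with $c(\omega,0)=1$, $c'(\omega,0)=h$, $s(\omega,0)=0$, $s'(\omega,0)=\omega$, and of the analogous series for $c'$, $s'$. Where negative powers of $x$ occur (case $n=1$), the relations are understood for $x\in(0,b]$. *)

(* Defs.v *)
From Stdlib Require Import Reals ZArith Lra Lia Bool.
From Coquelicot Require Import Coquelicot.
Open Scope R_scope.

Definition Icc (a b : R) : R -> Prop := fun x => a <= x <= b.

(* The derivative relative to a set D: it is one-sided at an end point of an
   interval, and values outside D play no role.  With D the whole line this is
   Coquelicot's [is_derive]. *)
Definition is_derive_on (D : R -> Prop) (g : R -> C) (x : R) (l : C) : Prop :=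
  filterdiff (V := C_R_NormedModule) g (within D (locally x))
    (fun y : R => scal y l).

Definition ex_derive_on (D : R -> Prop) (g : R -> C) (x : R) : Prop :=
  exists l : C, is_derive_on D g x l.

Definition Derive_on (D : R -> Prop) (g : R -> C) (x : R) : C :=
  iota (T := C_R_CompleteNormedModule) (is_derive_on D g x).

Definition CInt (g : R -> C) (a b : R) : C :=
  RInt (V := C_R_CompleteNormedModule) g a b.

(* The function equal to g away from 0, extended to 0 by its limit from the
   right. *)
Definition extend0 (g : R -> C) (x : R) : C :=
  if Req_EM_T x 0
  then iota (T := C_R_CompleteNormedModule)
         (fun l : C => filterlim g (at_right 0) (locally l))
  else g x.

(* The coefficient of x^k in P_n, from P_0 = 1, P_1 = x and Bonnet's recursion
   (m + 1) P_{m+1} = (2 m + 1) x P_m - m P_{m-1}. *)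
Fixpoint legendre_coef (n k : nat) {struct n} : R :=
  match n with
  | O => if Nat.eqb k 0 then 1 else 0
  | S m =>
    match m with
    | O => if Nat.eqb k 1 then 1 else 0
    | S m' =>
      ((2 * INR m + 1) *
         (match k with O => 0 | S k' => legendre_coef m k' end)
       - INR m * legendre_coef m' k) / INR (S m)
    end
  end.

Definition legendre (n : nat) (x : R) : R :=
  sum_n (fun k => legendre_coef n k * x ^ k) n.

Lemma legendre_coef_gt (n k : nat) : (n < k)%nat -> legendre_coef n k = 0.
Proof.
revert k.
induction n as [[|[|n]] IH] using lt_wf_ind; intros k Hk.
- destruct k; [lia|reflexivity].
- destruct k as [|[|k]]; [lia|lia|reflexivity].
- change (((2 * INR (S n) + 1) *
         (match k with O => 0 | S k' => legendre_coef (S n) k' end)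
       - INR (S n) * legendre_coef n k) / INR (S (S n)) = 0).
  destruct k as [|k]; [lia|].
  rewrite (IH (S n)), (IH n) by lia.
  unfold Rdiv; ring.
Qed.

Definition legendre_moment (j k : nat) : R :=
  RInt (fun y => legendre j y * y ^ k) (-1) 1.

Open Scope C_scope.

(* (f^2)^((-1)^n) *)
Definition sq_sign (f : R -> C) (n : nat) (s : R) : C :=
  if Nat.even n then f s ^ 2 else / (f s ^ 2).

Fixpoint formal_power (f : R -> C) (n : nat) (x : R) {struct n} : C :=
  match n with
  | O => RtoC 1
  | S m => RtoC (INR n) * CInt (fun s => formal_power f m s * sq_sign f n s) 0 x
  end.

Fixpoint formal_power_t (f : R -> C) (n : nat) (x : R) {struct n} : C :=
  match n with
  | O => RtoC 1
  | S m => RtoC (INR n) * CInt (fun s => formal_power_t f m s * sq_sign f m s) 0 x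
  end.

Definition phi (f : R -> C) (k : nat) (x : R) : C :=
  if Nat.even k then f x * formal_power_t f k x else f x * formal_power f k x.

(* The sum over the j of the parity of k with 0 <= j <= k - 2 is an inner
   fixpoint only to make the recursion structural, see [beta_pos_SS]. *)
Fixpoint beta_pos (f : R -> C) (k : nat) (x : R) {struct k} : C :=
  match k with
  | O => (f x - RtoC 1) / RtoC 2
  | S O => RtoC (3 / 2) * (phi f 1 x / RtoC x - RtoC 1)
  | S (S m) =>
    / RtoC (legendre_moment k k) *
      (phi f k x / RtoC x ^ k - RtoC 1 -
       (fix sum (i : nat) : C :=
          let t := if Bool.eqb (Nat.even i) (Nat.even k)
                   then RtoC (legendre_moment i k) * beta_pos f i x
                   else RtoC 0 in
          match i with
          | O => t
          | S i' => sum i' + t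
          end) m)
  end.

Lemma beta_pos_SS (f : R -> C) (m : nat) (x : R) :
  let k := S (S m) in
  beta_pos f k x =
    / RtoC (legendre_moment k k) *
      (phi f k x / RtoC x ^ k - RtoC 1 -
       sum_n (fun j => if Bool.eqb (Nat.even j) (Nat.even k)
                       then RtoC (legendre_moment j k) * beta_pos f j x
                       else RtoC 0) m).
Proof.
intros k.
unfold k at 1; cbn [beta_pos]; fold k.
do 2 f_equal.
set (F := fix sum (i : nat) : C := _).
assert (HF : forall i, F i = sum_n (fun j =>
    if Bool.eqb (Nat.even j) (Nat.even k)
    then RtoC (legendre_moment j k) * beta_pos f j x else RtoC 0) i).
{ induction i as [|i IH].
  - now rewrite sum_O.
  - rewrite sum_Sn, <- IH; reflexivity. }
now rewrite HF.
Qed.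

Definition beta (f : R -> C) (k : nat) : R -> C := extend0 (beta_pos f k).

Definition gamma_pos (b : R) (q f : R -> C) (n : nat) (x : R) : C :=
  RtoC ((2 * INR n + 1) / 2) *
    (sum_n (fun k => RtoC (legendre_coef n k)
                     * Derive_on (Icc 0 b) (phi f k) x / RtoC x ^ k) n
     - RtoC (INR n * (INR n + 1) / (2 * x))
     - RtoC (1 / 2) * CInt q 0 x
     - Derive_on (Icc 0 b) f 0 / RtoC 2 * RtoC (1 + (-1) ^ n)).

Definition gamma (b : R) (q f : R -> C) (n : nat) : R -> C :=
  extend0 (gamma_pos b q f n).

(* Indices n >= -1; for n < -1 the values below are irrelevant. *)
Definition betaZ (f : R -> C) (n : Z) (x : R) : C :=
  if (n <? 0)%Z then RtoC (1 / 2) else beta f (Z.to_nat n) x.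

Definition gammaZ (b : R) (q f : R -> C) (n : Z) (x : R) : C :=
  if (n <? 0)%Z then RtoC (1 / 4) * CInt q 0 x
  else gamma b q f (Z.to_nat n) x.

Definition sigmaZ (f : R -> C) (n : Z) (x : R) : C :=
  RtoC (powerRZ x n) * betaZ f n x.

Definition tauZ (b : R) (q f : R -> C) (n : Z) (x : R) : C :=
  RtoC (powerRZ x n) * gammaZ b q f n x.

Definition twice_derivable_at (D : R -> Prop) (g : R -> C) (x : R) : Prop :=
  ex_derive_on D g x /\ ex_derive_on D (Derive_on D g) x.

Definition Derive2_on (D : R -> Prop) (g : R -> C) : R -> C :=
  Derive_on D (Derive_on D g).

Definition is_solution (b : R) (q f : R -> C) : Prop :=
  forall x : R, Icc 0 b x ->
    twice_derivable_at (Icc 0 b) f x /\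
    Derive2_on (Icc 0 b) f x - q x * f x = RtoC 0.

(* Main.v *)
Require Import Defs.
From Stdlib Require Import Reals ZArith Lra Lia Bool.
From Coquelicot Require Import Coquelicot.
Open Scope C_scope.

(** Write l_{k,n} for the coefficients of P_n.  The recurrences become
    identities between these coefficients once beta_n has the closed form

      beta_n = (2 n + 1)/2 (sum_k l_{k,n} phi_k / x^k - 1),

    which is [beta_pos_closed]: the recursive definition of beta_n is the
    triangular system whose solution is given by the Legendre expansion
    y^k = sum_j (2 j + 1)/2 p_{j,k} P_j(y), see [legendre_inversion].  Both this
    expansion and the vanishing of p_{j,k} for j > k and for different parities
    follow from Bonnet's recursion, which the moments inherit, and from the
    vanishing of the integral of P_j for j >= 1.

    Multiplied by x^n, the closed form reads
    sigma_n = (2 n + 1)/2 (sum_k l_{k,n} x^{n-k} phi_k - x^n) on all of [0, b].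
    The functions phi_k satisfy phi_k'' = q phi_k + k (k - 1) phi_{k-2}
    ([dphi_deriv]).  So, apart from the terms that come from x^n, the function
    sigma_n'' - q sigma_n is a combination of the x^{n-k-2} phi_k and the
    x^{n-k-1} phi_k' with constant coefficients.  Comparing them with those of
    the right-hand side leaves, for m = n - 2,

      (n - k) l_{k,n} = - (m + k + 1) l_{k,m}

    ([legendre_coef_step2]) together with Legendre's differential equation
    ([legendre_coef_ode]); see [hsum1_rec], [hsum2_rec] and [sigma_core_rec].
    In sigma_n' - tau_n the derivatives phi_k' cancel, and the first of the two
    relations alone gives the recurrence for tau_n ([tau_defect_rec]).  The case
    n = 1, where sigma_{-1} = 1/(2 x), is a direct computation.

    Derivatives on [0, b] are one-sided at the end points.  They are handled
    through the slope function ([is_derive_on_slope]), for which the product and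
    quotient rules are statements about continuity. *)

(** * Finite sums of complex numbers *)

(** A sum of complex numbers is typed in the abelian monoid carried by [C], a
    type on which [ring] and [field] fail; this restores the type [C]. *)
Ltac at_C := match goal with |- @eq _ ?x ?y => change (@eq C x y) end.

Ltac push_RtoC :=
  repeat first [rewrite RtoC_plus | rewrite RtoC_minus | rewrite RtoC_opp | rewrite RtoC_mult].

Lemma csum_plus (u v : nat -> C) (n : nat) :
  sum_n (fun k => u k + v k) n = sum_n u n + sum_n v n.
Proof. exact (sum_n_plus (G := C_AbelianMonoid) u v n). Qed.

Lemma csum_mult (c : C) (u : nat -> C) (n : nat) :
  sum_n (fun k => c * u k) n = c * sum_n u n.
Proof. exact (sum_n_mult_l (K := C_Ring) c u n). Qed.

Lemma csum_S (u : nat -> C) (n : nat) :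
  sum_n u (S n) = sum_n u n + u (S n).
Proof. exact (sum_Sn (G := C_AbelianMonoid) u n). Qed.

Lemma csum_O (u : nat -> C) : sum_n u 0 = u 0%nat.
Proof. exact (sum_O (G := C_AbelianMonoid) u). Qed.

Lemma csum_shift (u : nat -> C) (n : nat) :
  sum_n u (S n) = u 0%nat + sum_n (fun k => u (S k)) n.
Proof.
induction n as [|n IH].
- now rewrite csum_S, !csum_O.
- rewrite csum_S, IH, csum_S; at_C; ring.
Qed.

Lemma csum_trim (u : nat -> C) (n d : nat) :
  (forall k, (n < k <= n + d)%nat -> u k = RtoC 0) ->
  sum_n u (n + d) = sum_n u n.
Proof.
induction d as [|d IH]; intros H.
- now rewrite Nat.add_0_r.
- rewrite Nat.add_succ_r, csum_S, IH, H by (intros; try apply H; lia); at_C; ring.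
Qed.

(** * Coefficients of the Legendre polynomials *)

Section LegendreCoefficients.
Open Scope R_scope.
Notation a := legendre_coef.

Lemma legendre_coef_bonnet (n k : nat) :
  INR (S (S n)) * a (S (S n)) k =
  (2 * INR (S n) + 1) * (match k with O => 0 | S k' => a (S n) k' end)
  - INR (S n) * a n k.
Proof.
change (a (S (S n)) k) with (((2 * INR (S n) + 1) *
         (match k with O => 0 | S k' => a (S n) k' end)
       - INR (S n) * a n k) / INR (S (S n))).
field. apply not_0_INR; lia.
Qed.

(** These are P_{n+1}' = x P_n' + (n + 1) P_n and
    P_n' = x P_{n+1}' - (n + 1) P_{n+1} read on coefficients.  Given Bonnet's
    recursion, the pair at n + 1 follows from the pair at n, and each
    relation uses the other, hence the joint induction. *)
Lemma legendre_coef_deriv (n : nat) :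
  (forall k, INR (S k) * a (S n) (S k) = (INR k + INR n + 1) * a n k) /\
  (forall k, INR (S k) * a n (S k) = (INR k - INR (S n)) * a (S n) k).
Proof.
induction n as [|n [IHC IHD]].
- split; intros [|[|k]]; cbn [legendre_coef Nat.eqb]; rewrite ?S_INR; simpl INR; ring.
- assert (HC : forall k, INR (S k) * a (S (S n)) (S k)
                         = (INR k + INR (S n) + 1) * a (S n) k).
  { intros k.
    apply Rmult_eq_reg_l with (INR (S (S n))); [|apply not_0_INR; lia].
    transitivity (INR (S k) * (INR (S (S n)) * a (S (S n)) (S k))); [ring|].
    rewrite legendre_coef_bonnet.
    transitivity (INR (S k) * (2 * INR (S n) + 1) * a (S n) k
                  - INR (S n) * (INR (S k) * a n (S k))); [ring|].
    rewrite IHD, !S_INR; ring. }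
  split; [exact HC|].
  intros k.
  apply Rmult_eq_reg_l with (INR (S (S n))); [|apply not_0_INR; lia].
  transitivity ((INR k - INR (S (S n))) * (INR (S (S n)) * a (S (S n)) k)); [|ring].
  rewrite legendre_coef_bonnet, IHC.
  destruct k as [|k].
  + rewrite !S_INR; simpl INR; ring.
  + transitivity ((2 * INR (S n) + 1) * ((INR k - INR (S n)) * a (S n) k)
      - INR (S n) * (INR (S k) - INR (S (S n))) * a n (S k)).
    * rewrite <- IHD, !S_INR; ring.
    * rewrite !S_INR; ring.
Qed.

(** The only relation between P_n and P_{n+2} that the recurrences need; it
    comes from going through P_{n+1} with the two derivative relations. *)
Lemma legendre_coef_step2 (n k : nat) :
  (INR (S (S n)) - INR k) * a (S (S n)) k = - (INR n + INR k + 1) * a n k.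
Proof.
destruct (legendre_coef_deriv n) as [HC _].
destruct (legendre_coef_deriv (S n)) as [_ HD].
transitivity (- (INR (S k) * a (S n) (S k))); [rewrite HD; ring|].
rewrite HC; ring.
Qed.

(** Legendre's equation (1 - x^2) P'' - 2 x P' + n (n + 1) P = 0 on
    coefficients. *)
Lemma legendre_coef_ode (n k : nat) :
  INR (S k) * INR (S (S k)) * a n (S (S k)) =
  (INR k * (INR k + 1) - INR n * (INR n + 1)) * a n k.
Proof.
destruct n as [|n].
- destruct k as [|k]; cbn [legendre_coef Nat.eqb]; rewrite ?S_INR; simpl INR; ring.
- destruct (legendre_coef_deriv n) as [HC HD].
  transitivity (INR (S k) * (INR (S (S k)) * a (S n) (S (S k)))); [ring|].
  rewrite HC.
  transitivity ((INR (S k) + INR n + 1) * (INR (S k) * a n (S k))); [ring|].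
  rewrite HD, !S_INR; ring.
Qed.
End LegendreCoefficients.

(** * Legendre expansion of the powers *)

(** The linear functional x^k |-> A_k applied to P_n.  Evaluation of P_n, its
    moments, and the sums over phi_k in sigma_n are all of this form. *)
Definition legendre_sum (A : nat -> C) (n : nat) : C :=
  sum_n (fun k => RtoC (legendre_coef n k) * A k) n.

Lemma legendre_sum_long (A : nat -> C) (n d : nat) :
  legendre_sum A n = sum_n (fun k => RtoC (legendre_coef n k) * A k) (n + d).
Proof.
symmetry; apply csum_trim; intros k Hk.
rewrite legendre_coef_gt by lia; ring.
Qed.

(** Multiplying a polynomial by x shifts the sequence A. *)
Lemma legendre_sum_bonnet (A : nat -> C) (n : nat) :
  RtoC (INR (S (S n))) * legendre_sum A (S (S n)) =
  RtoC (2 * INR (S n) + 1) * legendre_sum (fun k => A (S k)) (S n)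
  - RtoC (INR (S n)) * legendre_sum A n.
Proof.
rewrite (legendre_sum_long A n 2).
replace (n + 2)%nat with (S (S n)) by lia.
unfold legendre_sum.
set (b := fun k => match k with O => RtoC 0
                   | S k' => RtoC (legendre_coef (S n) k') * A k end).
replace (sum_n (fun k => RtoC (legendre_coef (S n) k) * A (S k)) (S n))
  with (sum_n b (S (S n))) by (rewrite csum_shift; unfold b; at_C; ring).
match goal with |- _ = ?x - ?c * ?y => replace (x - c * y) with (x + (- c) * y) by ring end.
rewrite <- !csum_mult, <- csum_plus.
apply sum_n_ext; intros k.
rewrite Cmult_assoc, <- RtoC_mult, legendre_coef_bonnet.
unfold b; destruct k; rewrite RtoC_minus, !RtoC_mult; at_C; ring.
Qed.


Lemma legendre_sum_mult (c : C) (A : nat -> C) (n : nat) :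
  legendre_sum (fun k => c * A k) n = c * legendre_sum A n.
Proof.
unfold legendre_sum; rewrite <- csum_mult.
apply sum_n_ext; intros k; at_C; ring.
Qed.

Lemma INR_S_neq0 (n : nat) : RtoC (INR (S n)) <> RtoC 0.
Proof. intros E; apply RtoC_inj in E; revert E; apply not_0_INR; lia. Qed.

(** P_n(1) = 1 and P_n(-1) = (-1)^n. *)
Lemma legendre_sum_pow (r : R) (n : nat) :
  (r * r = 1)%R -> legendre_sum (fun k => RtoC (r ^ k)) n = RtoC (r ^ n).
Proof.
intros Hr.
assert (H : legendre_sum (fun k => RtoC (r ^ k)) n = RtoC (r ^ n) /\
            legendre_sum (fun k => RtoC (r ^ k)) (S n) = RtoC (r ^ S n)); [|easy].
induction n as [|n [IH IH']]; split; try easy.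
- unfold legendre_sum; rewrite csum_O; cbn; at_C; ring.
- unfold legendre_sum; rewrite csum_S, csum_O; cbn; rewrite Rmult_1_r; at_C; ring.
- assert (Hn := INR_S_neq0 (S n)).
  assert (E := legendre_sum_bonnet (fun k => RtoC (r ^ k)) n).
  cbn beta in E.
  (* written with the factor r * r, to be replaced by 1 *)
  replace (legendre_sum (fun k => RtoC (r ^ S k)) (S n))
    with (RtoC (r * r * r ^ n)) in E.
  2: { rewrite Rmult_assoc, RtoC_mult; change (r * r ^ n)%R with (r ^ S n)%R.
       rewrite <- IH', <- legendre_sum_mult.
       apply sum_n_ext; intros k; simpl pow; now rewrite RtoC_mult. }
  rewrite IH in E.
  replace (legendre_sum _ (S (S n)))
    with (/ RtoC (INR (S (S n))) * (RtoC (INR (S (S n))) *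
            legendre_sum (fun k => RtoC (r ^ k)) (S (S n)))) by (field; exact Hn).
  rewrite E, <- !RtoC_mult. rewrite <- RtoC_minus, <- RtoC_inv, <- RtoC_mult
    by (apply not_0_INR; lia).
  apply f_equal.
  replace (r ^ S (S n))%R with (r * r * r ^ n)%R by (simpl pow; ring).
  rewrite Hr, !S_INR.
  assert (H := pos_INR n).
  field; lra.
Qed.

Definition power_moment (i : nat) : R := ((1 - (-1) ^ S i) / INR (S i))%R.

Lemma is_RInt_power (i : nat) :
  is_RInt (fun y : R => y ^ i)%R (-1) 1 (power_moment i).
Proof.
assert (Hi := pos_INR i).
replace (power_moment i)
  with (minus ((fun y : R => y ^ S i / INR (S i)) 1) ((fun y : R => y ^ S i / INR (S i)) (-1)))%R.
2: { unfold power_moment, minus, plus, opp; cbn -[INR pow].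
     rewrite pow1; idtac. field; rewrite S_INR; lra. }
apply (is_RInt_derive (V := R_CompleteNormedModule) (fun y : R => y ^ S i / INR (S i))%R).
- intros y _; auto_derive; [easy|].
  destruct i; rewrite <- ?S_INR; simpl INR in *; field; lra.
- intros y _.
  apply (ex_derive_continuous (fun y : R => y ^ i)%R); auto_derive; easy.
Qed.

Lemma legendre_moment_sum (j k : nat) :
  RtoC (legendre_moment j k) =
  legendre_sum (fun m => RtoC (power_moment (m + k))) j.
Proof.
assert (H : forall n, is_RInt (fun y : R =>
    sum_n (fun m => legendre_coef j m * y ^ m) n * y ^ k)%R (-1) 1
    (sum_n (fun m => legendre_coef j m * power_moment (m + k)) n)%R).
{ assert (Hm : forall m, is_RInt (fun y : R => legendre_coef j m * y ^ m * y ^ k)%R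
             (-1) 1 (legendre_coef j m * power_moment (m + k))%R).
  { intros m.
    apply (is_RInt_ext (fun y : R => scal (legendre_coef j m) (y ^ (m + k))%R)).
    - intros y _; unfold scal; cbn; unfold mult; cbn; rewrite pow_add; ring.
    - apply (is_RInt_scal (V := R_NormedModule)), is_RInt_power. }
  induction n as [|n IH].
  - rewrite sum_O. eapply is_RInt_ext; [|apply (Hm 0%nat)].
    intros y _; cbn beta; now rewrite sum_O.
  - rewrite sum_Sn.
    eapply is_RInt_ext; [|apply (is_RInt_plus (V := R_NormedModule) _ _ _ _ _ _ IH (Hm (S n)))].
    intros y _; cbn beta; rewrite sum_Sn; unfold plus; cbn -[sum_n legendre_coef pow]; ring. }
unfold legendre_moment, legendre.
rewrite (is_RInt_unique _ _ _ _ (H j)).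
unfold legendre_sum; generalize j at 2 4; intros n; induction n as [|n IH].
- rewrite csum_O, sum_O; now rewrite RtoC_mult.
- rewrite csum_S, sum_Sn, <- IH, <- RtoC_mult, <- RtoC_plus; reflexivity.
Qed.

(** The moments inherit Bonnet's recursion, since the functional that defines
    them is shifted when the power k increases.  The last
    term is absent at j = 0. *)
Lemma legendre_moment_rec (j k : nat) :
  ((2 * INR j + 1) * legendre_moment j (S k) =
   (INR j + 1) * legendre_moment (S j) k + INR j * legendre_moment (pred j) k)%R.
Proof.
apply RtoC_inj.
assert (E : legendre_sum (fun m => RtoC (power_moment (S m + k))) j =
            RtoC (legendre_moment j (S k))).
{ rewrite legendre_moment_sum; apply sum_n_ext; intros m.
  now rewrite Nat.add_succ_r. }
destruct j as [|j].
- rewrite RtoC_plus, !RtoC_mult, <- E, legendre_moment_sum.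
  unfold legendre_sum; rewrite csum_S, !csum_O; cbn -[legendre_moment]; rewrite ?Rmult_0_r; rewrite ?RtoC_plus; at_C; ring.
- assert (B := legendre_sum_bonnet (fun m => RtoC (power_moment (m + k))) j).
  cbn beta in B; rewrite E, <- !legendre_moment_sum in B.
  replace (INR (S j) + 1)%R with (INR (S (S j))) by now rewrite (S_INR (S j)).
  rewrite RtoC_plus, !RtoC_mult, B; cbn [pred]; rewrite RtoC_plus, !RtoC_mult; ring.
Qed.

(** The integral of P_j over [-1, 1] vanishes for j >= 1 because
    (2 j + 1) P_j = P_{j+1}' - P_{j-1}' and P_{j+1}, P_{j-1} have the same values
    at both end points. *)
Lemma legendre_moment_S0 (j : nat) : legendre_moment (S j) 0 = 0%R.
Proof.
apply RtoC_inj.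
(* [legendre_sum A n] is P_n(1) - P_n(-1) *)
set (A := fun k => RtoC (1 ^ k) + - RtoC 1 * RtoC ((-1) ^ k)).
assert (HA : forall n, legendre_sum A (S (S n)) = legendre_sum A n).
{ assert (H : forall n, legendre_sum A n = RtoC (1 ^ n) + - RtoC 1 * RtoC ((-1) ^ n)).
  { intros n; rewrite <- !legendre_sum_pow, <- legendre_sum_mult by ring.
    unfold legendre_sum; rewrite <- csum_plus.
    apply sum_n_ext; intros k; unfold A; at_C; ring. }
  intros n; rewrite !H, !pow1; simpl pow.
  now replace (-1 * (-1 * (-1) ^ n))%R with ((-1) ^ n)%R by ring. }
assert (Hn : RtoC (2 * INR (S j) + 1) <> RtoC 0).
{ intros E; apply RtoC_inj in E; assert (H := pos_INR (S j)); lra. }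
rewrite <- (Cmult_1_l (RtoC (legendre_moment _ _))), <- (Cinv_l _ Hn), <- Cmult_assoc.
replace (RtoC (2 * INR (S j) + 1) * RtoC (legendre_moment (S j) 0))
  with (legendre_sum A (S (S j)) - legendre_sum A j); [rewrite HA; ring|].
rewrite legendre_moment_sum, (legendre_sum_long _ (S j) 0), (legendre_sum_long A j 2).
replace (j + 2)%nat with (S (S j)) by lia; rewrite Nat.add_0_r.
unfold legendre_sum.
rewrite (csum_shift (fun k => RtoC (legendre_coef (S (S j)) k) * A k)).
rewrite (csum_shift (fun k => RtoC (legendre_coef j k) * A k)).
replace (A 0%nat) with (RtoC 0) by (unfold A; cbn; ring).
rewrite !Cmult_0_r, !Cplus_0_l.
match goal with |- ?x - ?y = _ => transitivity (x + - RtoC 1 * y); [ring|] end.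
rewrite <- !csum_mult, <- csum_plus.
apply sum_n_ext; intros k.
destruct (legendre_coef_deriv (S j)) as [HC _].
destruct (legendre_coef_deriv j) as [_ HD].
unfold A, power_moment; rewrite Nat.add_0_r, pow1.
rewrite <- !RtoC_mult, <- !RtoC_opp, <- !RtoC_mult, <- !RtoC_plus, <- !RtoC_mult, <- !RtoC_plus.
apply f_equal.
assert (Hk : INR (S k) <> 0%R) by (apply not_0_INR; lia).
apply Rmult_eq_reg_l with (INR (S k)); [|exact Hk].
transitivity ((INR (S k) * legendre_coef (S (S j)) (S k)
  - INR (S k) * legendre_coef j (S k)) * (1 - (-1) ^ S k))%R; [ring|].
rewrite HC, HD; field; exact Hk.
Qed.

(** Induction on k with [legendre_moment_rec]: a step changes j and k by one
    each, so that it preserves both conditions. *)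
Lemma legendre_moment_zero (k : nat) : forall j : nat,
  ((k < j)%nat \/ Nat.even j <> Nat.even k) -> legendre_moment j k = 0%R.
Proof.
induction k as [|k IH]; intros j Hj.
- destruct j as [|j]; [|apply legendre_moment_S0].
  destruct Hj as [Hj|Hj]; [lia|easy].
- apply Rmult_eq_reg_l with (2 * INR j + 1)%R; [|assert (H := pos_INR j); lra].
  rewrite legendre_moment_rec, (IH (S j)).
  2: { destruct Hj as [Hj|Hj]; [left; lia|right].
       rewrite Nat.even_succ, <- Nat.negb_even; intros E; apply Hj.
       now rewrite Nat.even_succ, <- Nat.negb_even, <- E, negb_involutive. }
  destruct j as [|j]; [simpl INR; ring|].
  cbn [pred]; rewrite (IH j); [ring|].
  destruct Hj as [Hj|Hj]; [left; lia|right; intros E; apply Hj].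
  now rewrite !Nat.even_succ, <- !Nat.negb_even, E.
Qed.

Lemma legendre_moment_00 : legendre_moment 0 0 = 2%R.
Proof.
apply RtoC_inj; rewrite legendre_moment_sum.
unfold legendre_sum; rewrite csum_O; cbn; rewrite <- RtoC_mult.
apply f_equal; unfold power_moment; cbn; field.
Qed.

Lemma legendre_moment_diag (k : nat) : (0 < legendre_moment k k)%R.
Proof.
induction k as [|k IH].
- rewrite legendre_moment_00; lra.
- assert (E := legendre_moment_rec (S k) k); cbn [pred] in E.
  rewrite (legendre_moment_zero k (S (S k))), S_INR in E by (left; lia).
  assert (H := pos_INR k).
  apply Rmult_lt_reg_l with (2 * (INR k + 1) + 1)%R; [lra|].
  rewrite E, Rmult_0_r, Rmult_0_r, Rplus_0_l; apply Rmult_lt_0_compat; lra.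
Qed.

(** The Legendre expansion y^k = sum_j (2 j + 1)/2 p_{j,k} P_j, stated under an
    arbitrary linear functional.  The induction on k multiplies the expansion
    by y, expands y P_j by Bonnet's recursion, and collects the coefficient of
    each P_j with [legendre_moment_rec]; the functional has to be arbitrary
    because multiplication by y shifts it. *)
Lemma legendre_inversion (k : nat) : forall A : nat -> C,
  sum_n (fun j => RtoC ((2 * INR j + 1) / 2 * legendre_moment j k) * legendre_sum A j) k
  = A k.
Proof.
induction k as [|k IH]; intros A.
- rewrite csum_O; unfold legendre_sum; rewrite csum_O.
  rewrite legendre_moment_00; cbn.
  replace ((2 * 0 + 1) / 2 * 2)%R with 1%R by field; at_C; ring.
- rewrite <- (IH (fun i => A (S i))).
  set (p := fun j => RtoC (legendre_moment j k)).
  set (L := legendre_sum A).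
  set (u := fun j => match j with O => RtoC 0
                     | S i => RtoC (INR j) * p i * L j end).
  set (v := fun j => RtoC (INR j) * p j * L (pred j)).
  (* u collects the part (i + 1) P_{i+1} of y P_i at the index i + 1, and v the
     part i P_{i-1} at the index i *)
  transitivity (RtoC (/ 2) * (sum_n u (S k) + sum_n v k)).
  + rewrite <- (csum_trim v k 2).
    2: { intros j Hj; unfold v, p; rewrite legendre_moment_zero by (left; lia); ring. }
    replace (k + 2)%nat with (S (S k)) by lia.
    rewrite (csum_shift v (S k)).
    replace (v 0%nat) with (RtoC 0) by (unfold v; cbn; ring).
    rewrite Cplus_0_l, <- csum_plus, <- csum_mult.
    apply sum_n_ext; intros j.
    replace ((2 * INR j + 1) / 2 * legendre_moment j (S k))%R
      with (/ 2 * ((2 * INR j + 1) * legendre_moment j (S k)))%R by field.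
    rewrite legendre_moment_rec.
    unfold u, v, p; destruct j as [|j]; cbn [pred].
    * simpl INR; push_RtoC; fold L; at_C; ring.
    * rewrite (S_INR (S j)); push_RtoC; fold L; at_C; ring.
  + rewrite csum_shift; unfold u at 1.
    rewrite Cplus_0_l, <- csum_plus, <- csum_mult.
    apply sum_n_ext; intros j.
    replace ((2 * INR j + 1) / 2 * legendre_moment j k)%R
      with (/ 2 * legendre_moment j k * (2 * INR j + 1))%R by field.
    rewrite RtoC_mult, <- Cmult_assoc.
    replace (RtoC (2 * INR j + 1) * legendre_sum (fun i => A (S i)) j)
      with (RtoC (INR (S j)) * L (S j) + RtoC (INR j) * L (pred j)).
    { unfold u, v, p; rewrite RtoC_mult; at_C; ring. }
    destruct j as [|j]; cbn [pred]; unfold L.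
    * unfold legendre_sum; rewrite csum_S, !csum_O; cbn; replace (2*0+1)%R with 1%R by ring. at_C; ring.
    * rewrite legendre_sum_bonnet; ring.
Qed.

(** * Closed form of the coefficients beta *)

(** The recursive definition of beta_k says
    sum_{j <= k} p_{j,k} beta_j = phi_k / x^k - 1, since p_{j,k} = 0 when the
    parities differ.  This triangular system has nonzero diagonal, and the
    closed form solves it by the Legendre expansion of y^k, applied to the
    functional y^k |-> phi_k / x^k and to evaluation at 1. *)
Lemma beta_pos_closed (f : R -> C) (n : nat) (x : R) :
  beta_pos f n x =
  RtoC ((2 * INR n + 1) / 2)
  * (legendre_sum (fun k => phi f k x / RtoC x ^ k) n - RtoC 1).
Proof.
induction n as [[|[|m]] IH] using lt_wf_ind.
- unfold legendre_sum; rewrite csum_O; cbn -[Cinv Cdiv].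
  unfold phi; cbn [Nat.even formal_power_t].
  replace ((2 * 0 + 1) / 2)%R with (/ 2)%R by field.
  rewrite RtoC_inv by lra; field.
- unfold legendre_sum; rewrite csum_S, csum_O.
  cbn -[Cinv Cdiv phi].
  replace ((2 * 1 + 1) / 2)%R with (3 / 2)%R by field; rewrite Cmult_1_r; ring.
- rewrite beta_pos_SS. cbv zeta.
  set (k := S (S m)). set (A := fun k => phi f k x / RtoC x ^ k).
  set (B := fun j => RtoC ((2 * INR j + 1) / 2) * (legendre_sum A j - RtoC 1)).
  assert (H : sum_n (fun j => RtoC (legendre_moment j k) * B j) k = A k - RtoC 1).
  { rewrite <- (legendre_inversion k A) at 1.
    rewrite <- (legendre_inversion k (fun _ => RtoC 1)).
    match goal with |- _ = ?x - ?y => transitivity (x + - RtoC 1 * y); [|at_C; ring] end.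
    rewrite <- csum_mult, <- csum_plus; apply sum_n_ext; intros j.
    replace (legendre_sum (fun _ => RtoC 1) j) with (RtoC 1).
    2: { transitivity (legendre_sum (fun k => RtoC (1 ^ k)) j).
         - now rewrite legendre_sum_pow, pow1 by ring.
         - apply sum_n_ext; intros i; now rewrite pow1. }
    unfold B; rewrite !RtoC_mult; at_C; ring. }
  fold (B k). change (phi f k x / RtoC x ^ k) with (A k).
  assert (Hk : RtoC (legendre_moment k k) <> RtoC 0).
  { intros E; apply RtoC_inj in E; assert (P := legendre_moment_diag k); lra. }
  rewrite (sum_n_ext_loc _ (fun j => RtoC (legendre_moment j k) * B j)).
  + rewrite <- H; rewrite (csum_S _ (S m)), (csum_S _ m); fold k.
    rewrite (legendre_moment_zero k (S m)).
    * field; exact Hk.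
    * right; unfold k; rewrite !(Nat.even_succ (S m)), <- Nat.negb_even.
      now destruct (Nat.even (S m)).
  + intros j Hj; destruct (Bool.eqb _ _) eqn:E.
    * rewrite IH by (unfold k; lia); reflexivity.
    * rewrite legendre_moment_zero; [at_C; ring|right].
      intros E'; rewrite E', Bool.eqb_reflx in E; discriminate.
Qed.

(** * Differentiation relative to a set *)

Definition cont_at (D : R -> Prop) (g : R -> C) (x : R) : Prop :=
  filterlim g (within D (locally x)) (locally (T := C_UniformSpace) (g x)).

Lemma within_proper (D : R -> Prop) (x : R) :
  D x -> ProperFilter (within D (locally x)).
Proof.
intros Hx; constructor.
- intros P [e He]; exists x; apply He; [apply ball_center|exact Hx].
- apply within_filter, locally_filter.
Qed.

Lemma norm_Cmod (z : C) : norm (V := C_R_NormedModule) z = Cmod z.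
Proof.
unfold norm; cbn; unfold prod_norm, norm, Cmod; cbn -[pow]; unfold abs; cbn -[pow].
now rewrite !pow2_abs.
Qed.

Lemma scal_RtoC (r : R) (z : C) : scal (V := C_R_NormedModule) r z = RtoC r * z.
Proof.
destruct z; unfold scal; cbn; unfold prod_scal, scal; cbn; unfold mult; cbn.
unfold Cmult, RtoC; cbn; f_equal; ring.
Qed.

Lemma cont_at_eps (D : R -> Prop) (g : R -> C) (x : R) :
  cont_at D g x <->
  forall eps : posreal, within D (locally x) (fun y => (Cmod (g y - g x) < eps)%R).
Proof.
unfold cont_at.
rewrite (filterlim_locally_ball_norm (U := C_R_NormedModule) g (g x)).
unfold ball_norm; split; intros H eps; specialize (H eps); revert H;
  apply filter_imp; intros y; rewrite norm_Cmod; easy.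
Qed.

Lemma cont_at_const (D : R -> Prop) (c : C) (x : R) : cont_at D (fun _ => c) x.
Proof. apply filterlim_const. Qed.

Lemma cont_at_RtoC (D : R -> Prop) (x : R) : cont_at D RtoC x.
Proof.
apply cont_at_eps; intros eps; exists eps; intros y Hy _.
rewrite <- RtoC_minus, Cmod_R; exact Hy.
Qed.

Lemma cont_at_plus (D : R -> Prop) (g h : R -> C) (x : R) :
  cont_at D g x -> cont_at D h x -> cont_at D (fun y => g y + h y) x.
Proof.
intros Hg Hh.
apply (filterlim_comp_2 g h Cplus Hg Hh).
apply (filterlim_plus (V := C_R_NormedModule)).
Qed.

Lemma cont_at_mult (D : R -> Prop) (g h : R -> C) (x : R) :
  cont_at D g x -> cont_at D h x -> cont_at D (fun y => g y * h y) x.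
Proof.
intros Hg Hh.
assert (E : forall (u : R -> C) (z : C) (F : (R -> Prop) -> Prop),
  filterlim u F (locally (T := C_UniformSpace) z) <->
  filterlim u F (locally (T := AbsRing_UniformSpace C_AbsRing) z)).
{ intros u z F; split; intros H P HP; apply H, locally_C, HP. }
apply E; apply E in Hg; apply E in Hh.
apply (filterlim_comp_2 g h Cmult Hg Hh).
apply (filterlim_mult (K := C_AbsRing)).
Qed.

Lemma cont_at_inv (D : R -> Prop) (g : R -> C) (x : R) :
  cont_at D g x -> g x <> RtoC 0 -> cont_at D (fun y => / g y) x.
Proof.
rewrite !cont_at_eps; intros Hg Hx eps.
assert (Hm := proj1 (Cmod_gt_0 _) Hx); set (m := Cmod (g x)) in *.
assert (He := cond_pos eps).
assert (Hd : (0 < Rmin (m / 2) (eps * (m * m / 2)))%R).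
{ apply Rmin_pos; [lra|]. apply Rmult_lt_0_compat; [lra|].
  assert (0 < m * m)%R by (apply Rmult_lt_0_compat; lra). lra. }
generalize (Hg (mkposreal _ Hd)); apply filter_imp; intros y Hy.
cbn [pos] in Hy.
assert (H1 := Rlt_le_trans _ _ _ Hy (Rmin_l _ _)).
assert (H2 := Rlt_le_trans _ _ _ Hy (Rmin_r _ _)).
assert (Hy2 : (m / 2 < Cmod (g y))%R).
{ assert (T := Cmod_triangle (g y) (- (g y - g x))).
  replace (g y + - (g y - g x)) with (g x) in T by ring.
  rewrite Cmod_opp in T; fold m in T; lra. }
assert (Hy0 : g y <> RtoC 0) by (apply Cmod_gt_0; lra).
replace (/ g y - / g x) with (- (g y - g x) / (g y * g x)) by (field; easy).
rewrite Cmod_div, Cmod_opp, Cmod_mult by (apply Cmult_neq_0; easy).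
fold m.
apply Rmult_lt_reg_r with (Cmod (g y) * m)%R; [apply Rmult_lt_0_compat; lra|].
replace (Cmod (g y - g x) / (Cmod (g y) * m) * (Cmod (g y) * m))%R
  with (Cmod (g y - g x)) by (field; lra).
apply Rlt_le_trans with (1 := H2).
apply Rmult_le_compat_l; [lra|].
replace (m * m / 2)%R with (m / 2 * m)%R by field.
apply Rmult_le_compat_r; lra.
Qed.

(** Caratheodory's form of differentiability.  It turns the rules of calculus
    relative to D into continuity statements for the slope [psi], and needs no
    distinction between interior and end points. *)
Lemma is_derive_on_intro (D : R -> Prop) (g psi : R -> C) (x : R) :
  D x -> cont_at D psi x ->
  within D (locally x) (fun y => g y = g x + RtoC (y - x) * psi y) ->
  is_derive_on D g x (psi x).
Proof.
intros Dx Hc Hg; split; [apply (is_linear_scal_l (K := R_AbsRing) (V := C_R_NormedModule))|].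
intros x' Hx'.
assert (P := within_proper D x Dx).
assert (Ex : x' = x).
{ apply (is_filter_lim_unique (V := R_NormedModule) (F := within D (locally x)));
    [exact Hx'|apply filter_le_within]. }
subst x'.
intros eps.
generalize (filter_and _ _ Hg (proj1 (cont_at_eps _ _ _) Hc eps)).
apply filter_imp; intros y [Ey Hy].
change (norm (V := C_R_NormedModule) (g y - g x - scal (V := C_R_NormedModule) (y - x)%R (psi x))%C
        <= eps * Rabs (y - x))%R.
rewrite norm_Cmod, scal_RtoC, Ey.
replace (g x + RtoC (y - x) * psi y - g x - RtoC (y - x) * psi x)
  with (RtoC (y - x) * (psi y - psi x)) by ring.
rewrite Cmod_mult, Cmod_R, Rmult_comm.
apply Rmult_le_compat_r; [apply Rabs_pos|lra].
Qed.

Lemma is_derive_on_slope (D : R -> Prop) (g : R -> C) (x : R) (l : C) :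
  D x ->
  is_derive_on D g x l <->
  exists psi : R -> C, cont_at D psi x /\ psi x = l /\
    forall y, D y -> g y = g x + RtoC (y - x) * psi y.
Proof.
intros Dx; split.
- intros [_ H].
  assert (Hlim : is_filter_lim (within D (locally x)) x).
  { apply filter_le_within. }
  specialize (H x Hlim).
  exists (fun y => if Req_EM_T y x then l else (g y - g x) / RtoC (y - x)).
  split; [|split].
  + apply cont_at_eps; intros eps.
    destruct (Req_EM_T x x) as [_|]; [|easy].
    assert (He : (0 < eps / 2)%R) by (destruct eps; cbn; lra).
    generalize (H (mkposreal _ He)); apply filter_imp; intros y.
    destruct (Req_EM_T y x) as [->|Hxy].
    * intros _; replace (l - l) with (RtoC 0) by ring; rewrite Cmod_0; apply cond_pos.
    * assert (Hn : RtoC (y - x) <> RtoC 0) by (intros E; apply RtoC_inj in E; lra).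
      intros Hy.
      change (norm (V := C_R_NormedModule) (g y - g x - scal (V := C_R_NormedModule) (y - x)%R l)%C
        <= eps / 2 * Rabs (y - x))%R in Hy.
      rewrite norm_Cmod, scal_RtoC in Hy.
      replace ((g y - g x) / RtoC (y - x) - l)
        with ((g y - g x - RtoC (y - x) * l) / RtoC (y - x)) by (field; exact Hn).
      rewrite Cmod_div, Cmod_R by exact Hn.
      assert (0 < Rabs (y - x))%R by (apply Rabs_pos_lt; lra).
      apply Rle_lt_trans with (eps / 2)%R; [|destruct eps; cbn; lra].
      apply Rmult_le_reg_r with (Rabs (y - x)); [easy|].
      unfold Rdiv at 1; rewrite Rmult_assoc, Rinv_l, Rmult_1_r by lra; exact Hy.
  + now destruct (Req_EM_T x x).
  + intros y _; destruct (Req_EM_T y x) as [->|Hxy];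
      [rewrite Rminus_diag; ring|].
    field; intros E; apply RtoC_inj in E; lra.
- intros (psi & Hc & <- & Hg); apply is_derive_on_intro; [exact Dx|exact Hc|].
  unfold within; apply filter_forall; exact Hg.
Qed.

Lemma is_derive_on_cont (D : R -> Prop) (g : R -> C) (x : R) (l : C) :
  D x -> is_derive_on D g x l -> cont_at D g x.
Proof.
intros Dx H; apply is_derive_on_slope in H; [|exact Dx].
destruct H as (psi & Hc & _ & Hg).
assert (H : cont_at D (fun y => g x + (y + RtoC (- x)) * psi y) x).
{ apply cont_at_plus; [apply cont_at_const|].
  apply cont_at_mult; [|exact Hc].
  apply cont_at_plus; [apply cont_at_RtoC|apply cont_at_const]. }
unfold cont_at in *.
replace (g x + (x + RtoC (- x)) * psi x) with (g x) in H.
2: { rewrite <- RtoC_plus, Rplus_opp_r; ring. }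
revert H; apply filterlim_within_ext; intros y Dy.
rewrite (Hg y Dy), <- RtoC_plus; reflexivity.
Qed.

Lemma is_derive_on_ext (D : R -> Prop) (g h : R -> C) (x : R) (l : C) :
  D x -> (forall y, D y -> g y = h y) -> is_derive_on D g x l -> is_derive_on D h x l.
Proof.
intros Dx E H; apply is_derive_on_slope in H; [|exact Dx].
apply is_derive_on_slope; [exact Dx|].
destruct H as (psi & Hc & Hl & Hg); exists psi; repeat split; try easy.
intros y Dy; rewrite <- !E by easy; auto.
Qed.

(** Differentiability at x > 0 does not see the value at 0; this is what makes
    x |-> 1 / x tractable on [0, b]. *)
Lemma is_derive_on_ext_pos (b : R) (g h : R -> C) (x : R) (l : C) :
  (0 < x <= b)%R -> (forall y, (0 < y <= b)%R -> g y = h y) ->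
  is_derive_on (Icc 0 b) g x l -> is_derive_on (Icc 0 b) h x l.
Proof.
intros Hx E.
assert (P := within_proper (Icc 0 b) x ltac:(unfold Icc; lra)).
apply filterdiff_ext_loc.
- exists (mkposreal x (proj1 Hx)); intros y Hy [Dy Dy']; apply E; split; [|lra].
  change (Rabs (y - x) < x)%R in Hy; apply Rabs_def2 in Hy; lra.
- intros y Hy; replace y with x; [now apply E|].
  apply (is_filter_lim_unique (V := R_NormedModule) (F := within (Icc 0 b) (locally x)));
    [apply filter_le_within|exact Hy].
Qed.

Lemma is_derive_on_const (D : R -> Prop) (c : C) (x : R) :
  D x -> is_derive_on D (fun _ => c) x (RtoC 0).
Proof.
intros Dx; apply is_derive_on_slope; [exact Dx|].
exists (fun _ => RtoC 0); repeat split; [apply cont_at_const|intros; ring].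
Qed.

Lemma is_derive_on_RtoC (D : R -> Prop) (x : R) :
  D x -> is_derive_on D RtoC x (RtoC 1).
Proof.
intros Dx; apply is_derive_on_slope; [exact Dx|].
exists (fun _ => RtoC 1); repeat split; [apply cont_at_const|].
intros y _; rewrite RtoC_minus; ring.
Qed.

Lemma is_derive_on_plus (D : R -> Prop) (g h : R -> C) (x : R) (l m : C) :
  D x -> is_derive_on D g x l -> is_derive_on D h x m ->
  is_derive_on D (fun y => g y + h y) x (l + m).
Proof.
intros Dx Hg Hh; apply is_derive_on_slope in Hg; apply is_derive_on_slope in Hh; try easy.
destruct Hg as (u & Cu & <- & Hu), Hh as (v & Cv & <- & Hv).
apply is_derive_on_slope; [exact Dx|].
exists (fun y => u y + v y); repeat split; [now apply cont_at_plus|].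
intros y Dy; rewrite Hu, Hv by easy; ring.
Qed.

Lemma is_derive_on_mult (D : R -> Prop) (g h : R -> C) (x : R) (l m : C) :
  D x -> is_derive_on D g x l -> is_derive_on D h x m ->
  is_derive_on D (fun y => g y * h y) x (l * h x + g x * m).
Proof.
intros Dx Hg Hh; assert (Ch := is_derive_on_cont _ _ _ _ Dx Hh).
apply is_derive_on_slope in Hg; apply is_derive_on_slope in Hh; try easy.
destruct Hg as (u & Cu & <- & Hu), Hh as (v & Cv & <- & Hv).
apply is_derive_on_slope; [exact Dx|].
exists (fun y => u y * h y + g x * v y); repeat split.
- apply cont_at_plus; apply cont_at_mult; try easy; apply cont_at_const.
- intros y Dy; rewrite Hu, (Hv y) by easy; ring.
Qed.

Lemma is_derive_on_scal (D : R -> Prop) (c : C) (g : R -> C) (x : R) (l : C) :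
  D x -> is_derive_on D g x l -> is_derive_on D (fun y => c * g y) x (c * l).
Proof.
intros Dx Hg; replace (c * l) with (RtoC 0 * g x + c * l) by ring.
apply (is_derive_on_mult D (fun _ => c)); [exact Dx| |exact Hg].
now apply is_derive_on_const.
Qed.

Lemma is_derive_on_minus (D : R -> Prop) (g h : R -> C) (x : R) (l m : C) :
  D x -> is_derive_on D g x l -> is_derive_on D h x m ->
  is_derive_on D (fun y => g y - h y) x (l - m).
Proof.
intros Dx Hg Hh.
apply is_derive_on_ext with (fun y => g y + - RtoC 1 * h y); [exact Dx|intros; ring|].
replace (l - m) with (l + (RtoC 0 * h x + - RtoC 1 * m)) by ring.
apply is_derive_on_plus; [exact Dx|exact Hg|].
apply (is_derive_on_mult D (fun _ => - RtoC 1)); [exact Dx| |exact Hh].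
now apply is_derive_on_const.
Qed.

Lemma is_derive_on_inv (D : R -> Prop) (g : R -> C) (x : R) (l : C) :
  D x -> g x <> RtoC 0 -> is_derive_on D g x l ->
  is_derive_on D (fun y => / g y) x (- l / (g x * g x)).
Proof.
intros Dx Hx Hg; assert (Cg := is_derive_on_cont _ _ _ _ Dx Hg).
apply is_derive_on_slope in Hg; [|easy].
destruct Hg as (u & Cu & <- & Hu).
set (psi := fun y => - RtoC 1 * u y * (/ g y * / g x)).
replace (- u x / (g x * g x)) with (psi x) by (unfold psi; field; exact Hx).
apply is_derive_on_intro; [exact Dx| |].
- apply cont_at_mult; [apply cont_at_mult; [apply cont_at_const|easy]|].
  apply cont_at_mult; [apply cont_at_inv; auto|apply cont_at_const].
- assert (Hm := proj1 (Cmod_gt_0 _) Hx).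
  destruct (proj1 (cont_at_eps _ _ _) Cg (mkposreal _ Hm)) as [d Hd].
  exists d; intros y By Dy; specialize (Hd y By Dy); cbn [pos] in Hd.
  assert (Hy : g y <> RtoC 0).
  { intros E; rewrite E in Hd; replace (RtoC 0 - g x) with (- g x) in Hd by ring.
    rewrite Cmod_opp in Hd; lra. }
  assert (E : RtoC (y - x) * u y = g y - g x) by (rewrite (Hu y Dy); ring).
  unfold psi.
  transitivity (/ g x + - RtoC 1 * (RtoC (y - x) * u y) * (/ g y * / g x)); [|ring].
  rewrite E; field; auto.
Qed.

Lemma is_derive_on_pow (D : R -> Prop) (n : nat) (x : R) :
  D x -> is_derive_on D (fun y => RtoC (y ^ n)) x (RtoC (INR n * x ^ pred n)).
Proof.
intros Dx; induction n as [|n IH].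
- replace (RtoC (INR 0 * x ^ pred 0)) with (RtoC 0) by (simpl INR; now rewrite Rmult_0_l).
  exact (is_derive_on_const D (RtoC 1) x Dx).
- apply is_derive_on_ext with (fun y => RtoC y * RtoC (y ^ n)); [exact Dx| |].
  { intros y _; now rewrite <- RtoC_mult. }
  replace (RtoC (INR (S n) * x ^ pred (S n)))
    with (RtoC 1 * RtoC (x ^ n) + RtoC x * RtoC (INR n * x ^ pred n)).
  + apply (is_derive_on_mult D RtoC (fun y => RtoC (y ^ n))); auto; now apply is_derive_on_RtoC.
  + rewrite <- !RtoC_mult, <- RtoC_plus; apply f_equal.
    rewrite S_INR; destruct n; simpl; ring.
Qed.

Lemma is_derive_on_sum (D : R -> Prop) (g : nat -> R -> C) (l : nat -> C) (n : nat) (x : R) :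
  D x -> (forall k, (k <= n)%nat -> is_derive_on D (g k) x (l k)) ->
  is_derive_on D (fun y => sum_n (fun k => g k y) n) x (sum_n l n).
Proof.
intros Dx; induction n as [|n IH]; intros H.
- rewrite sum_O; apply is_derive_on_ext with (g 0%nat); [exact Dx| |apply H; lia].
  intros y _; now rewrite sum_O.
- rewrite sum_Sn.
  apply is_derive_on_ext with (fun y => sum_n (fun k => g k y) n + g (S n) y); [exact Dx| |].
  + intros y _; now rewrite sum_Sn.
  + apply is_derive_on_plus; [exact Dx| |apply H; lia].
    apply IH; intros; apply H; lia.
Qed.

Lemma Derive_on_unique (b : R) (g : R -> C) (x : R) (l : C) :
  (0 < b)%R -> Icc 0 b x -> is_derive_on (Icc 0 b) g x l -> Derive_on (Icc 0 b) g x = l.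
Proof.
intros Hb Hx H; apply (iota_unique (V := C_R_CompleteNormedModule)); [|exact H].
intros m Hm.
apply is_derive_on_slope in H; apply is_derive_on_slope in Hm; try easy.
destruct H as (u & Cu & <- & Hu), Hm as (v & Cv & <- & Hv).
(* x is not isolated in the interval *)
assert (Acc : forall e : posreal, exists y, Icc 0 b y /\ ball x e y /\ y <> x).
{ intros e.
  set (d := (Rmin (e / 2) (if Rlt_dec x b then b - x else x))%R).
  assert (Hd : (0 < d <= e / 2)%R).
  { split; [|apply Rmin_l]. destruct e as [e He]; cbn in d.
    apply Rmin_pos; [lra|]. destruct (Rlt_dec x b); [lra|destruct Hx; lra]. }
  assert (Hd' := Rmin_r (e / 2) (if Rlt_dec x b then b - x else x)); fold d in Hd'.
  exists (if Rlt_dec x b then x + d else x - d)%R.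
  assert (He := cond_pos e).
  split; [|split].
  - unfold Icc in *; destruct (Rlt_dec x b); lra.
  - change (Rabs ((if Rlt_dec x b then x + d else x - d) - x) < e)%R.
    destruct (Rlt_dec x b); apply Rabs_def1; lra.
  - destruct (Rlt_dec x b); lra. }
assert (E : Cmod (v x - u x) = 0%R).
{ apply Rle_antisym; [|apply Cmod_ge_0].
  apply le_epsilon; intros eps He.
  assert (He2 : (0 < eps / 2)%R) by lra.
  destruct (filter_and _ _ (proj1 (cont_at_eps _ _ _) Cu (mkposreal _ He2))
                          (proj1 (cont_at_eps _ _ _) Cv (mkposreal _ He2))) as [d Hd].
  destruct (Acc d) as (y & Dy & By & Ny).
  destruct (Hd y By Dy) as [H1 H2]; cbn [pos] in H1, H2.
  assert (Hn : RtoC (y - x) <> RtoC 0) by (intros E; apply RtoC_inj in E; lra).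
  assert (Euv : u y = v y).
  { replace (u y) with ((g x + RtoC (y - x) * u y - g x) / RtoC (y - x)) by (field; easy).
    rewrite <- (Hu y Dy), (Hv y Dy); field; easy. }
  rewrite Rplus_0_l.
  replace (v x - u x) with ((u y - u x) + - (v y - v x)) by (rewrite Euv; ring).
  assert (T := Cmod_triangle (u y - u x) (- (v y - v x))); rewrite Cmod_opp in T; lra. }
apply Cmod_eq_0 in E.
change (v x = u x); transitivity (v x - u x + u x); [ring|rewrite E; ring].
Qed.

(** The fundamental theorem of calculus up to the end points: precomposing g
    with the projection of the line onto [0, b] gives a continuous function on
    the whole line with the same integrals, so that the two-sided theorem
    applies. *)
Lemma is_derive_on_CInt (b : R) (g : R -> C) (x : R) :
  (forall y, Icc 0 b y -> cont_at (Icc 0 b) g y) -> Icc 0 b x ->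
  is_derive_on (Icc 0 b) (fun y => CInt g 0 y) x (g x).
Proof.
intros Hg Hx.
set (cl := fun y => Rmax 0 (Rmin b y)).
assert (Hcl : forall y, Icc 0 b (cl y)).
{ intros y; split; [apply Rmax_l|].
  apply Rmax_lub; [destruct Hx; lra|apply Rmin_l]. }
assert (Hid : forall y, Icc 0 b y -> cl y = y).
{ intros y [H0 H1]; unfold cl; rewrite Rmin_right, Rmax_right; lra. }
assert (Lip : forall y z, (Rabs (cl z - cl y) <= Rabs (z - y))%R).
{ intros y z; unfold cl, Rmax, Rmin; destruct Hx.
  repeat destruct (Rle_dec _ _); unfold Rabs; repeat destruct (Rcase_abs _); lra. }
set (gc := fun y => g (cl y)).
assert (Hgc : forall y, continuous (U := C_R_NormedModule) gc y).
{ intros y; unfold continuous, gc.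
  apply filterlim_comp with (within (Icc 0 b) (locally (cl y))); [|apply Hg, Hcl].
  intros P [e He]; exists e; intros z Hz; apply He; [|apply Hcl].
  apply Rle_lt_trans with (2 := Hz); apply Lip. }
apply is_derive_on_ext with (fun y => CInt gc 0 y); [exact Hx| |].
{ intros y Hy; apply (RInt_ext (V := C_R_CompleteNormedModule)); intros z Hz.
  destruct Hy; rewrite Rmin_left, Rmax_right in Hz by lra.
  unfold gc; rewrite Hid; [easy|unfold Icc; lra]. }
assert (H : is_derive (V := C_R_NormedModule) (fun y => CInt gc 0 y) x (gc x)).
{ apply is_derive_RInt with 0%R; [|apply Hgc].
  apply filter_forall; intros y.
  apply (RInt_correct (V := C_R_CompleteNormedModule)).
  apply (ex_RInt_continuous (V := C_R_CompleteNormedModule)); intros; apply Hgc. }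
unfold gc at 2 in H; rewrite Hid in H by exact Hx.
destruct H as [Hl H]; split; [exact Hl|].
intros x' Hx'.
assert (P := within_proper (Icc 0 b) x Hx).
assert (Ex : x = x').
{ apply (is_filter_lim_unique (V := R_NormedModule) (F := within (Icc 0 b) (locally x))); [apply filter_le_within|exact Hx']. }
subst x'.
intros eps; apply filter_le_within.
apply (H x); intros Q HQ; exact HQ.
Qed.

Lemma CInt_point (g : R -> C) (x : R) : CInt g x x = RtoC 0.
Proof. exact (RInt_point (V := C_R_CompleteNormedModule) x g). Qed.

(** A function that agrees on (0, b] with one continuous at 0 is extended to 0
    by the value of the latter. *)
Lemma extend0_eq (b : R) (g h : R -> C) (x : R) :
  (0 < b)%R -> (forall y, (0 < y <= b)%R -> g y = h y) -> cont_at (Icc 0 b) h 0 ->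
  Icc 0 b x -> extend0 g x = h x.
Proof.
intros Hb E Ch Hx; unfold extend0.
destruct (Req_EM_T x 0) as [->|Hn]; [|apply E; destruct Hx; lra].
apply (iota_filterlim_locally (V := C_R_CompleteNormedModule)).
intros P HP; destruct (Ch P HP) as [d Hd].
assert (Hm : (0 < Rmin d b)%R) by (apply Rmin_pos; [apply cond_pos|exact Hb]).
exists (mkposreal _ Hm); intros y Hy Hy0.
change (Rabs (y - 0) < Rmin d b)%R in Hy.
assert (H1 := Rlt_le_trans _ _ _ Hy (Rmin_l _ _)).
assert (H2 := Rlt_le_trans _ _ _ Hy (Rmin_r _ _)).
rewrite Rabs_pos_eq in H2 by lra.
rewrite E by lra; apply Hd; [exact H1|unfold Icc; lra].
Qed.

(** * Homogenised Legendre sums *)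

Lemma legendre_sum_plus (A B : nat -> C) (n : nat) :
  legendre_sum (fun k => A k + B k) n = legendre_sum A n + legendre_sum B n.
Proof.
unfold legendre_sum; rewrite <- csum_plus; apply sum_n_ext; intros k; at_C; ring.
Qed.

Lemma csum_trim2 (u : nat -> C) (n : nat) :
  (forall k, (n < k <= n + 2)%nat -> u k = RtoC 0) -> sum_n u (S (S n)) = sum_n u n.
Proof.
intros H; replace (S (S n)) with (n + 2)%nat by lia; now apply csum_trim.
Qed.

(** x^n P_n(y / x) with y^k replaced by u_k.  Clearing the denominators of
    P_n in this way gives functions that are regular at x = 0. *)
Definition hsum (n : nat) (x : R) (u : nat -> C) : C :=
  legendre_sum (fun k => RtoC (x ^ (n - k)) * u k) n.

(** The first and second derivatives of [hsum] in x with u fixed.  The factors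
    [INR (n - k)] and [INR (pred (n - k))] cancel the terms in which a
    truncated exponent would be wrong. *)
Definition hsum1 (n : nat) (x : R) (u : nat -> C) : C :=
  legendre_sum (fun k => RtoC (INR (n - k) * x ^ pred (n - k)) * u k) n.

Definition hsum2 (n : nat) (x : R) (u : nat -> C) : C :=
  legendre_sum (fun k => RtoC (INR (n - k) * INR (pred (n - k)) * x ^ pred (pred (n - k))) * u k) n.

Lemma hsum_lin (n : nat) (x : R) (c : C) (u v : nat -> C) :
  hsum n x (fun k => c * u k + v k) = c * hsum n x u + hsum n x v.
Proof.
unfold hsum; rewrite <- legendre_sum_mult, <- legendre_sum_plus.
apply sum_n_ext; intros k; at_C; ring.
Qed.

Lemma hsum_deriv (D : R -> Prop) (n : nat) (x : R) (u : nat -> R -> C) (v : nat -> C) :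
  D x -> (forall k, is_derive_on D (u k) x (v k)) ->
  is_derive_on D (fun y => hsum n y (fun k => u k y)) x
    (hsum1 n x (fun k => u k x) + hsum n x v).
Proof.
intros Dx Hu; unfold hsum, hsum1; rewrite <- legendre_sum_plus; unfold legendre_sum.
apply (is_derive_on_sum D (fun k y => RtoC (legendre_coef n k) * (RtoC (y ^ (n - k)) * u k y)));
  [exact Dx|].
intros k _.
match goal with |- is_derive_on _ _ _ (?c * ?m) =>
  replace (c * m) with (RtoC 0 * (RtoC (x ^ (n - k)) * u k x) + c * m) by ring end.
apply (is_derive_on_mult D (fun _ => RtoC (legendre_coef n k))); [exact Dx| |].
- now apply is_derive_on_const.
- apply (is_derive_on_mult D (fun y => RtoC (y ^ (n - k)))); [exact Dx| |apply Hu].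
  now apply is_derive_on_pow.
Qed.

Lemma hsum1_deriv (D : R -> Prop) (n : nat) (x : R) (u : nat -> R -> C) (v : nat -> C) :
  D x -> (forall k, is_derive_on D (u k) x (v k)) ->
  is_derive_on D (fun y => hsum1 n y (fun k => u k y)) x
    (hsum2 n x (fun k => u k x) + hsum1 n x v).
Proof.
intros Dx Hu; unfold hsum1, hsum2; rewrite <- legendre_sum_plus; unfold legendre_sum.
apply (is_derive_on_sum D (fun k y => RtoC (legendre_coef n k) *
   (RtoC (INR (n - k) * y ^ pred (n - k)) * u k y))); [exact Dx|].
intros k _.
match goal with |- is_derive_on _ _ _ (?c * ?m) =>
  replace (c * m) with (RtoC 0 * (RtoC (INR (n - k) * x ^ pred (n - k)) * u k x) + c * m) by ring end.
apply (is_derive_on_mult D (fun _ => RtoC (legendre_coef n k))); [exact Dx| |].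
- now apply is_derive_on_const.
- apply (is_derive_on_mult D (fun y => RtoC (INR (n - k) * y ^ pred (n - k)))); [exact Dx| |apply Hu].
  apply is_derive_on_ext with (fun y => RtoC (INR (n - k)) * RtoC (y ^ pred (n - k)));
    [exact Dx|intros y _; now rewrite RtoC_mult|].
  replace (RtoC (INR (n - k) * INR (pred (n - k)) * x ^ pred (pred (n - k))))
    with (RtoC 0 * RtoC (x ^ pred (n - k)) +
          RtoC (INR (n - k)) * RtoC (INR (pred (n - k)) * x ^ pred (pred (n - k))))
    by (push_RtoC; ring).
  apply (is_derive_on_mult D (fun _ => RtoC (INR (n - k)))
           (fun y => RtoC (y ^ pred (n - k)))); [exact Dx| |].
  + now apply is_derive_on_const.
  + now apply is_derive_on_pow.
Qed.

Lemma hsum_at0 (n : nat) (u : nat -> C) :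
  hsum n 0 u = RtoC (legendre_coef n n) * u n.
Proof.
assert (H : forall m, (m <= n)%nat ->
  sum_n (fun k => RtoC (legendre_coef n k) * (RtoC (0 ^ (n - k)) * u k)) m =
  if Nat.eqb m n then RtoC (legendre_coef n n) * u n else RtoC 0).
{ induction m as [|m IH]; intros Hm.
  - rewrite csum_O; destruct (Nat.eqb_spec 0 n) as [<-|Hn].
    + cbn; at_C; ring.
    + rewrite pow_i by lia; at_C; ring.
  - rewrite csum_S, IH by lia.
    destruct (Nat.eqb_spec m n); [lia|].
    destruct (Nat.eqb_spec (S m) n) as [->|].
    + rewrite Nat.sub_diag; simpl pow; at_C; ring.
    + rewrite pow_i by lia; at_C; ring. }
unfold hsum, legendre_sum; rewrite H by lia.
now rewrite Nat.eqb_refl.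
Qed.

Lemma mult_pow_pred (j : nat) (x : R) : (x * (INR j * x ^ pred j) = INR j * x ^ j)%R.
Proof. destruct j; [simpl; ring|cbn [pred]; simpl pow; ring]. Qed.

Lemma mult_pow_pred2 (j : nat) (x : R) :
  (x ^ 2 * (INR j * INR (pred j) * x ^ pred (pred j)) = INR j * INR (pred j) * x ^ j)%R.
Proof. destruct j as [|[|j]]; cbn [pred]; simpl pow; [simpl;ring|simpl; ring|ring]. Qed.

(** [legendre_coef_step2] multiplied by the matching powers of x. *)
Lemma hsum1_rec (m : nat) (x : R) (u : nat -> C) :
  hsum1 (S (S m)) x u =
  RtoC (x ^ 2) * hsum1 m x u - RtoC ((2 * INR m + 1) * x) * hsum m x u.
Proof.
transitivity (RtoC (x ^ 2) * hsum1 m x u + RtoC (- ((2 * INR m + 1) * x)) * hsum m x u);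
  [|push_RtoC; ring].
unfold hsum1 at 1; unfold legendre_sum.
rewrite (csum_trim2 _ m).
2: { intros k Hk; destruct (Nat.eq_dec k (S m)) as [->|Hn].
     - assert (E := legendre_coef_step2 m (S m)).
       rewrite (legendre_coef_gt m (S m)), Rmult_0_r in E by lia.
       assert (E0 : legendre_coef (S (S m)) (S m) = 0%R).
       { rewrite !S_INR in E; lra. }
       rewrite E0; ring.
     - replace (S (S m) - k)%nat with 0%nat by lia; simpl INR.
       rewrite Rmult_0_l; ring. }
unfold hsum1, hsum, legendre_sum; rewrite <- !csum_mult, <- csum_plus.
apply sum_n_ext_loc; intros k Hk.
rewrite !Cmult_assoc, <- !RtoC_mult, <- Cmult_plus_distr_r, <- RtoC_plus.
do 2 f_equal.
assert (E := legendre_coef_step2 m k).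
replace (S (S m) - k)%nat with (S (S (m - k))) by lia; cbn [pred].
assert (EI : INR (S (S (m - k))) = (INR (S (S m)) - INR k)%R).
{ rewrite !S_INR, minus_INR by exact Hk; ring. }
rewrite EI.
transitivity (((INR (S (S m)) - INR k) * legendre_coef (S (S m)) k) * x ^ S (m - k))%R; [ring|].
rewrite E.
transitivity (legendre_coef m k * (x * (x * (INR (m - k) * x ^ pred (m - k))))
              - (2 * INR m + 1) * x * legendre_coef m k * x ^ (m - k))%R; [|simpl pow; ring].
rewrite mult_pow_pred, minus_INR by exact Hk; simpl pow; ring.
Qed.

(** If u_k is phi_k(x), the terms [u2] are the part k (k - 1) phi_{k-2} of
    phi_k''.  Shifting k by 2 in them lets all terms carry the same u_k; then
    Legendre's equation for n and n + 2 removes the shifted coefficients, and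
    what remains is [legendre_coef_step2]. *)
Lemma hsum2_rec (m : nat) (x : R) (u : nat -> C) :
  let u2 := fun k => RtoC (INR k * INR (pred k)) * u (pred (pred k)) in
  hsum2 (S (S m)) x u + hsum (S (S m)) x u2 =
  RtoC (x ^ 2) * (hsum2 m x u + hsum m x u2)
  - RtoC (2 * (2 * INR m + 1)) *
      (RtoC x * hsum1 m x u - RtoC (INR (S m)) * hsum m x u).
Proof.
intros u2.
(* the coefficients of u_k after the shift *)
set (d := fun n k => (INR (S k) * INR (S (S k)) * legendre_coef n (S (S k)))%R).
assert (V1 : hsum (S (S m)) x u2 = sum_n (fun k => RtoC (d (S (S m)) k * x ^ (m - k)) * u k) m).
{ unfold hsum, legendre_sum; rewrite !csum_shift; unfold u2, d; cbn [pred].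
  simpl (INR 0); rewrite !Rmult_0_l, Rmult_0_r.
  rewrite !Cmult_0_l, !Cmult_0_r, !Cplus_0_l.
  apply sum_n_ext; intros k; rewrite !Nat.sub_succ; push_RtoC; at_C; ring. }
assert (V2 : RtoC (x ^ 2) * hsum m x u2 = sum_n (fun k => RtoC (d m k * x ^ (m - k)) * u k) m).
{ unfold hsum; rewrite (legendre_sum_long _ m 2).
  replace (m + 2)%nat with (S (S m)) by lia.
  rewrite !csum_shift; unfold u2, d; cbn [pred].
  simpl (INR 0); rewrite !Rmult_0_l, Rmult_0_r.
  rewrite !Cmult_0_l, !Cmult_0_r, !Cplus_0_l, <- csum_mult.
  apply sum_n_ext; intros k.
  destruct (le_lt_dec (S (S k)) m) as [Hk|Hk].
  - replace (x ^ (m - k))%R with (x ^ 2 * x ^ (m - S (S k)))%R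
      by (rewrite <- pow_add; f_equal; lia).
    push_RtoC; at_C; ring.
  - rewrite legendre_coef_gt by lia; rewrite !Rmult_0_r, Rmult_0_l; at_C; ring. }
rewrite Cmult_plus_distr_l, V1, V2.
match goal with |- _ = ?a - ?c * (?x * ?y - ?e * ?z) =>
  transitivity (a + (- c * x) * y + (c * e) * z); [|ring] end.
unfold hsum2 at 1; unfold legendre_sum.
rewrite (csum_trim2 _ m).
2: { intros k Hk; replace (INR (S (S m) - k) * INR (pred (S (S m) - k)))%R with 0%R.
     - rewrite Rmult_0_l; ring.
     - assert (H : (S (S m) - k = 0 \/ S (S m) - k = 1)%nat) by lia.
       destruct H as [-> | ->]; simpl; ring. }
unfold hsum2, hsum1, hsum, legendre_sum; rewrite <- !csum_mult, <- !csum_plus.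
apply sum_n_ext_loc; intros k Hk.
rewrite <- !RtoC_opp.
rewrite !Cmult_assoc, <- !RtoC_mult, <- !Cmult_plus_distr_r, <- !RtoC_plus.
do 2 f_equal.
assert (E := legendre_coef_step2 m k).
assert (EI : INR (m - k) = (INR m - INR k)%R) by now apply minus_INR.
replace (S (S m) - k)%nat with (S (S (m - k))) by lia; cbn [pred].
assert (P1 := mult_pow_pred (m - k) x); assert (P2 := mult_pow_pred2 (m - k) x).
set (an := legendre_coef (S (S m)) k) in *.
set (am := legendre_coef m k) in *.
assert (D1 : d (S (S m)) k = ((INR k * (INR k + 1) - (INR m + 2) * (INR m + 3)) * an)%R).
{ unfold d; rewrite legendre_coef_ode; fold an; rewrite !S_INR; ring. }
assert (D2 : d m k = ((INR k * (INR k + 1) - INR m * (INR m + 1)) * am)%R).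
{ unfold d; rewrite legendre_coef_ode; fold am; ring. }
rewrite D1, D2.
set (j := (m - k)%nat) in *.
transitivity (am * (x ^ 2 * (INR j * INR (pred j) * x ^ pred (pred j)))
  + (INR k * (INR k + 1) - INR m * (INR m + 1)) * am * x ^ j
  - 2 * (2 * INR m + 1) * am * (x * (INR j * x ^ pred j))
  + 2 * (2 * INR m + 1) * INR (S m) * am * x ^ j)%R; [|ring].
rewrite P1, P2.
assert (PJ : (INR j * INR (pred j) = INR j * (INR j - 1))%R).
{ destruct j; [simpl; ring|cbn [pred]; rewrite S_INR; ring]. }
rewrite PJ, !S_INR.
rewrite !S_INR in E.
transitivity (((INR m + 1 + 1 - INR k) * an) * x ^ j * (-2 * (INR k + 1)))%R.
- rewrite EI; ring.
- rewrite E, EI; ring.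
Qed.

(** * The functions phi and their equations *)

Lemma sq_sign_eq (f : R -> C) (n : nat) (s : R) :
  sq_sign f n s = if Nat.even n then f s * f s else / (f s * f s).
Proof.
unfold sq_sign; replace (f s ^ 2) with (f s * f s) by (simpl; ring); reflexivity.
Qed.

Lemma sq_sign_cont (D : R -> Prop) (f : R -> C) (n : nat) (x : R) :
  cont_at D f x -> f x <> RtoC 0 -> cont_at D (sq_sign f n) x.
Proof.
intros Cf Hf.
assert (C2 : cont_at D (fun s => f s ^ 2) x).
{ unfold cont_at; simpl.
  exact (cont_at_mult D f (fun s => f s * RtoC 1) x Cf
           (cont_at_mult D f (fun _ => RtoC 1) x Cf (cont_at_const D _ x))). }
unfold sq_sign, cont_at; destruct (Nat.even n); [exact C2|].
apply (cont_at_inv D (fun s => f s ^ 2)); [exact C2|now apply Cpow_nz].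
Qed.

(** The derivative of P_n makes P_n continuous, which the fundamental theorem
    of calculus needs for P_{n+1}. *)
Lemma iterated_integral_deriv (b : R) (P w : nat -> R -> C) :
  (forall x, P 0%nat x = RtoC 1) ->
  (forall m x, P (S m) x = RtoC (INR (S m)) * CInt (fun s => P m s * w m s) 0 x) ->
  (forall m x, Icc 0 b x -> cont_at (Icc 0 b) (w m) x) ->
  forall n x, Icc 0 b x ->
  is_derive_on (Icc 0 b) (P n) x (RtoC (INR n) * (P (pred n) x * w (pred n) x)).
Proof.
intros P0 PS Cw n.
induction n as [|n IH]; intros x Hx.
- simpl INR; rewrite Cmult_0_l.
  apply is_derive_on_ext with (fun _ => RtoC 1); [exact Hx|easy|].
  now apply is_derive_on_const.
- cbn [pred].
  apply is_derive_on_ext with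
    (fun y => RtoC (INR (S n)) * CInt (fun s => P n s * w n s) 0 y); [exact Hx|easy|].
  replace (RtoC (INR (S n)) * (P n x * w n x))
    with (RtoC 0 * CInt (fun s => P n s * w n s) 0 x
          + RtoC (INR (S n)) * (P n x * w n x)) by ring.
  apply (is_derive_on_mult (Icc 0 b) (fun _ => RtoC (INR (S n)))
           (fun y => CInt (fun s => P n s * w n s) 0 y)); [exact Hx|now apply is_derive_on_const|].
  apply (is_derive_on_CInt b (fun s => P n s * w n s)); [|exact Hx].
  intros y Hy; apply cont_at_mult; [|now apply Cw].
  exact (is_derive_on_cont _ _ _ _ Hy (IH y Hy)).
Qed.

(** phi_k uses only one of the two families of formal powers, according to the
    parity of k, and phi_{k-2} uses the same one. *)
Definition same_parity_power (f : R -> C) (k : nat) : nat -> R -> C :=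
  if Nat.even k then formal_power_t f else formal_power f.

Lemma phi_eq (f : R -> C) (k : nat) (x : R) : phi f k x = f x * same_parity_power f k k x.
Proof. unfold phi, same_parity_power; now destruct (Nat.even k). Qed.

Lemma same_parity_power_O (f : R -> C) (k : nat) (x : R) :
  same_parity_power f k 0 x = RtoC 1.
Proof. unfold same_parity_power; now destruct (Nat.even k). Qed.

Lemma same_parity_power_S0 (f : R -> C) (k n : nat) :
  same_parity_power f k (S n) 0 = RtoC 0.
Proof.
unfold same_parity_power; destruct (Nat.even k); cbn [formal_power formal_power_t];
  rewrite CInt_point; ring.
Qed.

Lemma phi_S0 (f : R -> C) (k : nat) : phi f (S k) 0 = RtoC 0.
Proof. rewrite phi_eq, same_parity_power_S0; ring. Qed.

(** In either family the weight under the integral is 1/f^2 when the order has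
    the parity of k, and f^2 otherwise. *)
Lemma same_parity_power_deriv (b : R) (f : R -> C) (k n : nat) (x : R) :
  (forall y, Icc 0 b y -> cont_at (Icc 0 b) f y) ->
  (forall y, Icc 0 b y -> f y <> RtoC 0) -> Icc 0 b x ->
  is_derive_on (Icc 0 b) (same_parity_power f k n) x
    (RtoC (INR n) * same_parity_power f k (pred n) x *
     (if Bool.eqb (Nat.even n) (Nat.even k) then / (f x * f x) else f x * f x)).
Proof.
intros Cf Hf Hx.
set (w := fun m => if Nat.even k then sq_sign f m else sq_sign f (S m)).
assert (H : is_derive_on (Icc 0 b) (same_parity_power f k n) x
   (RtoC (INR n) * (same_parity_power f k (pred n) x * w (pred n) x))).
{ apply iterated_integral_deriv; [apply same_parity_power_O| | |exact Hx].
  - intros m y; unfold same_parity_power, w; now destruct (Nat.even k).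
  - intros m y Hy; unfold w; destruct (Nat.even k); apply sq_sign_cont; auto. }
destruct n as [|n].
- simpl INR in *; now rewrite Cmult_0_l in *; rewrite Cmult_0_l.
- cbn [pred] in *; rewrite <- Cmult_assoc.
  replace (if Bool.eqb (Nat.even (S n)) (Nat.even k) then / (f x * f x) else f x * f x)
    with (w n x); [exact H|].
  unfold w; destruct (Nat.even k); rewrite sq_sign_eq, (Nat.even_succ n), <- Nat.negb_even;
    now destruct (Nat.even n).
Qed.

Definition dphi (f f1 : R -> C) (k : nat) (x : R) : C :=
  f1 x * same_parity_power f k k x
  + RtoC (INR k) * same_parity_power f k (pred k) x / f x.

Lemma phi_deriv (b : R) (f f1 : R -> C) (k : nat) (x : R) :
  (forall y, Icc 0 b y -> is_derive_on (Icc 0 b) f y (f1 y)) ->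
  (forall y, Icc 0 b y -> f y <> RtoC 0) -> Icc 0 b x ->
  is_derive_on (Icc 0 b) (phi f k) x (dphi f f1 k x).
Proof.
intros Df Hf Hx.
assert (H := same_parity_power_deriv b f k k x
  (fun y Hy => is_derive_on_cont _ _ _ _ Hy (Df y Hy)) Hf Hx).
rewrite Bool.eqb_reflx in H.
apply is_derive_on_ext with (fun y => f y * same_parity_power f k k y);
  [exact Hx|intros y _; now rewrite phi_eq|].
assert (M := is_derive_on_mult _ _ _ _ _ _ Hx (Df x Hx) H).
replace (dphi f f1 k x) with
  (f1 x * same_parity_power f k k x +
    f x * (RtoC (INR k) * same_parity_power f k (pred k) x * / (f x * f x))); [exact M|].
unfold dphi; field; auto.
Qed.

(** This is phi_k'' = q phi_k + k (k - 1) phi_{k-2}: the terms in f' cancel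
    because the integrands alternate between 1/f^2 and f^2. *)
Lemma dphi_deriv (b : R) (q f f1 : R -> C) (k : nat) (x : R) :
  (forall y, Icc 0 b y -> is_derive_on (Icc 0 b) f y (f1 y)) ->
  (forall y, Icc 0 b y -> is_derive_on (Icc 0 b) f1 y (q y * f y)) ->
  (forall y, Icc 0 b y -> f y <> RtoC 0) -> Icc 0 b x ->
  is_derive_on (Icc 0 b) (dphi f f1 k) x
    (q x * phi f k x + RtoC (INR k * INR (pred k)) * phi f (pred (pred k)) x).
Proof.
intros Df Df1 Hf Hx.
assert (Cf := fun y Hy => is_derive_on_cont _ _ _ _ Hy (Df y Hy)).
assert (H := same_parity_power_deriv b f k k x Cf Hf Hx).
assert (H' := same_parity_power_deriv b f k (pred k) x Cf Hf Hx).
rewrite Bool.eqb_reflx in H.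
assert (I := is_derive_on_inv _ _ _ _ Hx (Hf x Hx) (Df x Hx)).
assert (Cst := is_derive_on_const (Icc 0 b) (RtoC (INR k)) x Hx).
assert (M := is_derive_on_plus _ _ _ _ _ _ Hx
  (is_derive_on_mult _ _ _ _ _ _ Hx (Df1 x Hx) H)
  (is_derive_on_mult _ _ _ _ _ _ Hx (is_derive_on_mult _ _ _ _ _ _ Hx Cst H') I)).
cbn beta in M.
match type of M with is_derive_on _ _ _ ?l =>
  replace (q x * phi f k x + RtoC (INR k * INR (pred k)) * phi f (pred (pred k)) x) with l;
    [exact M|] end.
rewrite !phi_eq.
assert (Hfx := Hf x Hx).
destruct k as [|[|k]].
- cbn [pred]; simpl INR; rewrite Rmult_0_l; field; auto.
- cbn [pred]; simpl INR; rewrite Rmult_0_r; field; auto.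
- cbn [pred].
  replace (Bool.eqb (Nat.even (S k)) (Nat.even (S (S k)))) with false.
  2: { rewrite (Nat.even_succ (S k)), <- Nat.negb_even; now destruct (Nat.even (S k)). }
  replace (same_parity_power f (S (S k))) with (same_parity_power f k) by reflexivity.
  rewrite RtoC_mult; field; auto.
Qed.

(** * The functions sigma and tau *)

Lemma powerRZ_nat (x : R) (n : nat) : powerRZ x (Z.of_nat n) = (x ^ n)%R.
Proof. symmetry; apply pow_powerRZ. Qed.

(** The function sigma_n without its factor (2 n + 1)/2. *)
Definition sigma_core (f : R -> C) (n : nat) (x : R) : C :=
  hsum n x (fun k => phi f k x) - RtoC (x ^ n).

(** For n >= 1 both sides vanish at x = 0, so that the limit which defines
    beta_n(0) never has to be computed; only beta_0(0) enters. *)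
Lemma sigma_eq (f : R -> C) (n : nat) (x : R) :
  f 0%R = RtoC 1 -> beta f 0 0 = RtoC 0 ->
  sigmaZ f (Z.of_nat n) x = RtoC ((2 * INR n + 1) / 2) * sigma_core f n x.
Proof.
intros f0 H0.
unfold sigmaZ, betaZ, sigma_core.
replace (Z.of_nat n <? 0)%Z with false by (symmetry; apply Z.ltb_ge; lia).
rewrite Nat2Z.id, powerRZ_nat.
destruct (Req_EM_T x 0) as [->|Hx].
- destruct n as [|n].
  + rewrite H0, hsum_at0, phi_eq, same_parity_power_O, f0; cbn.
    replace ((2 * 0 + 1) / 2)%R with (/ 2)%R by field.
    ring.
  + rewrite hsum_at0, phi_S0, pow_i by lia; ring.
- unfold beta, extend0; destruct (Req_EM_T x 0) as [|_]; [easy|].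
  rewrite beta_pos_closed.
  replace (hsum n x (fun k => phi f k x))
    with (RtoC (x ^ n) * legendre_sum (fun k => phi f k x / RtoC x ^ k) n); [ring|].
  rewrite <- legendre_sum_mult; unfold hsum, legendre_sum.
  apply sum_n_ext_loc; intros k Hk.
  replace (x ^ n)%R with (x ^ (n - k) * x ^ k)%R by (rewrite <- pow_add; f_equal; lia).
  rewrite RtoC_mult, <- RtoC_pow; at_C; field.
  intros E; apply RtoC_inj in E; revert E; now apply pow_nonzero.
Qed.

Definition sigma_core1 (f f1 : R -> C) (n : nat) (x : R) : C :=
  hsum1 n x (fun k => phi f k x) + hsum n x (fun k => dphi f f1 k x)
  - RtoC (INR n * x ^ pred n).

Definition sigma_core2 (q f f1 : R -> C) (n : nat) (x : R) : C :=
  hsum2 n x (fun k => phi f k x) + RtoC 2 * hsum1 n x (fun k => dphi f f1 k x)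
  + hsum n x (fun k => q x * phi f k x
                       + RtoC (INR k * INR (pred k)) * phi f (pred (pred k)) x)
  - RtoC (INR n * INR (pred n) * x ^ pred (pred n)).

Lemma sigma_core_deriv (b : R) (f f1 : R -> C) (n : nat) (x : R) :
  (forall y, Icc 0 b y -> is_derive_on (Icc 0 b) f y (f1 y)) ->
  (forall y, Icc 0 b y -> f y <> RtoC 0) -> Icc 0 b x ->
  is_derive_on (Icc 0 b) (sigma_core f n) x (sigma_core1 f f1 n x).
Proof.
intros Df Hf Hx; unfold sigma_core, sigma_core1.
apply is_derive_on_minus; [exact Hx| |now apply is_derive_on_pow].
apply hsum_deriv; [exact Hx|intros k].
now apply phi_deriv.
Qed.

Lemma sigma_core1_deriv (b : R) (q f f1 : R -> C) (n : nat) (x : R) :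
  (forall y, Icc 0 b y -> is_derive_on (Icc 0 b) f y (f1 y)) ->
  (forall y, Icc 0 b y -> is_derive_on (Icc 0 b) f1 y (q y * f y)) ->
  (forall y, Icc 0 b y -> f y <> RtoC 0) -> Icc 0 b x ->
  is_derive_on (Icc 0 b) (sigma_core1 f f1 n) x (sigma_core2 q f f1 n x).
Proof.
intros Df Df1 Hf Hx; unfold sigma_core1, sigma_core2.
apply is_derive_on_minus; [exact Hx| |].
- match goal with |- is_derive_on _ _ _ (?a + RtoC 2 * ?c + ?d) =>
    replace (a + RtoC 2 * c + d) with ((a + c) + (c + d)) by ring end.
  apply is_derive_on_plus; [exact Hx| |].
  + apply hsum1_deriv; [exact Hx|intros k]; now apply phi_deriv.
  + apply hsum_deriv; [exact Hx|intros k]; now apply dphi_deriv.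
- apply is_derive_on_ext with (fun y => RtoC (INR n) * RtoC (y ^ pred n));
    [exact Hx|intros y _; now rewrite RtoC_mult|].
  rewrite Rmult_assoc, RtoC_mult.
  apply (is_derive_on_scal _ _ (fun y => RtoC (y ^ pred n))); [exact Hx|].
  now apply is_derive_on_pow.
Qed.

(** The differential equation for sigma_{m+2}: [hsum2_rec] accounts for the
    terms in phi_k, [hsum1_rec] for those in phi_k', and the powers x^n satisfy
    the same recurrence by themselves. *)
Lemma sigma_core_rec (q f f1 : R -> C) (m : nat) (x : R) :
  sigma_core2 q f f1 (S (S m)) x - q x * sigma_core f (S (S m)) x =
  RtoC (x ^ 2) * (sigma_core2 q f f1 m x - q x * sigma_core f m x)
  - RtoC (2 * (2 * INR m + 1)) *
     (RtoC x * sigma_core1 f f1 m x - RtoC (INR (S m)) * sigma_core f m x).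
Proof.
unfold sigma_core2, sigma_core1, sigma_core; rewrite !hsum_lin.
assert (E1 := hsum1_rec m x (fun k => dphi f f1 k x)).
assert (E2 := hsum2_rec m x (fun k => phi f k x)); cbv zeta in E2; cbn beta in E2.
rewrite E1.
match type of E2 with ?a + ?c = ?r =>
  transitivity (r + RtoC 2 * (RtoC (x ^ 2) * hsum1 m x (fun k => dphi f f1 k x)
     - RtoC ((2 * INR m + 1) * x) * hsum m x (fun k => dphi f f1 k x))
    - RtoC (INR (S (S m)) * INR (pred (S (S m))) * x ^ pred (pred (S (S m))))
    + q x * RtoC (x ^ S (S m))); [rewrite <- E2; ring|] end.
assert (P : (INR (S (S m)) * INR (pred (S (S m))) * x ^ pred (pred (S (S m)))
  = x ^ 2 * (INR m * INR (pred m) * x ^ pred (pred m))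
    - 2 * (2 * INR m + 1) * (x * (INR m * x ^ pred m) - INR (S m) * x ^ m))%R).
{ rewrite mult_pow_pred, mult_pow_pred2; cbn [pred].
  replace (INR m * INR (pred m))%R with (INR m * (INR m - 1))%R.
  - rewrite !S_INR; ring.
  - destruct m; [simpl; ring|cbn [pred]; rewrite S_INR; ring]. }
rewrite P.
replace (x ^ S (S m))%R with (x ^ 2 * x ^ m)%R by (simpl; ring).
push_RtoC; ring.
Qed.

(** The difference sigma_n' - tau_n without its factor (2 n + 1)/2.  All the
    phi_k' cancel in it, which is why tau_n can be expressed by the functions
    sigma.  The number c stands for the terms in q and h, which depend on n
    through its parity alone. *)
Definition tau_defect (f : R -> C) (c : C) (n : nat) (x : R) : C :=
  hsum1 n x (fun k => phi f k x) + RtoC (INR n * INR (pred n) / 2 * x ^ pred n)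
  + RtoC (x ^ n) * c.

Lemma tau_defect_rec (f : R -> C) (c : C) (m : nat) (x : R) :
  tau_defect f c (S (S m)) x =
  RtoC (x ^ 2) * tau_defect f c m x - RtoC ((2 * INR m + 1) * x) * sigma_core f m x.
Proof.
unfold tau_defect, sigma_core; rewrite hsum1_rec.
assert (P : (INR (S (S m)) * INR (pred (S (S m))) / 2 * x ^ pred (S (S m)) =
  x ^ 2 * (INR m * INR (pred m) / 2 * x ^ pred m) + (2 * INR m + 1) * x * x ^ m)%R).
{ transitivity (x / 2 * INR (pred m) * (x * (INR m * x ^ pred m))
      + (2 * INR m + 1) * x * x ^ m)%R; [|field].
  rewrite mult_pow_pred; cbn [pred].
  transitivity (x / 2 * (INR m * INR (pred m)) * x ^ m + (2 * INR m + 1) * x * x ^ m)%R; [|ring].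
  replace (INR m * INR (pred m))%R with (INR m * (INR m - 1))%R.
  - rewrite !S_INR; simpl; field.
  - destruct m; [simpl; ring|cbn [pred]; rewrite S_INR; ring]. }
rewrite P.
replace (x ^ S (S m))%R with (x ^ 2 * x ^ m)%R by (simpl; ring).
push_RtoC; ring.
Qed.

Lemma tau_eq (b : R) (q f f1 : R -> C) (n : nat) (x : R) :
  (0 < x <= b)%R ->
  (forall y, Icc 0 b y -> is_derive_on (Icc 0 b) f y (f1 y)) ->
  (forall y, Icc 0 b y -> f y <> RtoC 0) ->
  let c := RtoC (1 / 2) * CInt q 0 x
           + Derive_on (Icc 0 b) f 0 / RtoC 2 * RtoC (1 + (-1) ^ n) in
  tauZ b q f (Z.of_nat n) x =
  RtoC ((2 * INR n + 1) / 2) * (sigma_core1 f f1 n x - tau_defect f c n x).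
Proof.
intros Hx Df Hf c.
assert (Ix : Icc 0 b x) by (unfold Icc; lra).
unfold tauZ, gammaZ.
replace (Z.of_nat n <? 0)%Z with false by (symmetry; apply Z.ltb_ge; lia).
rewrite Nat2Z.id, powerRZ_nat; unfold gamma, extend0.
destruct (Req_EM_T x 0) as [|_]; [lra|].
unfold gamma_pos.
assert (S1 : RtoC (x ^ n) * sum_n (fun k => RtoC (legendre_coef n k)
     * Derive_on (Icc 0 b) (phi f k) x / RtoC x ^ k) n = hsum n x (fun k => dphi f f1 k x)).
{ rewrite <- csum_mult; unfold hsum, legendre_sum.
  apply sum_n_ext_loc; intros k Hk.
  rewrite (Derive_on_unique b (phi f k) x (dphi f f1 k x));
    [|lra|exact Ix|now apply phi_deriv].
  replace (x ^ n)%R with (x ^ (n - k) * x ^ k)%R by (rewrite <- pow_add; f_equal; lia).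
  rewrite RtoC_mult, <- RtoC_pow; at_C; field.
  intros E; apply RtoC_inj in E; revert E; apply pow_nonzero; lra. }
assert (S2 : RtoC (x ^ n) * RtoC (INR n * (INR n + 1) / (2 * x))
   = RtoC (INR n * x ^ pred n + INR n * INR (pred n) / 2 * x ^ pred n)).
{ rewrite <- RtoC_mult; apply f_equal; destruct n; [simpl; field; lra|].
  cbn [pred]; rewrite S_INR; simpl pow; field; lra. }
match goal with |- RtoC (x ^ n) * (?a * (?s - ?p - ?y - ?z)) = _ =>
  transitivity (a * (RtoC (x ^ n) * s - RtoC (x ^ n) * p - RtoC (x ^ n) * c));
  [unfold c; ring|] end.
rewrite S1, S2; unfold sigma_core1, tau_defect; push_RtoC; ring.
Qed.

Lemma sigma_core_S0 (f : R -> C) (n : nat) : sigma_core f (S n) 0 = RtoC 0.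
Proof. unfold sigma_core; rewrite hsum_at0, phi_S0, pow_i by lia; ring. Qed.

Lemma sigma_core1_S0 (f f1 : R -> C) (n : nat) : f 0%R = RtoC 1 -> sigma_core1 f f1 (S n) 0 = RtoC 0.
Proof.
intros f0; unfold sigma_core1, dphi; rewrite hsum_at0, same_parity_power_S0, f0; cbn [pred].
destruct n as [|n].
- rewrite same_parity_power_O; unfold hsum1, legendre_sum.
  rewrite csum_S, csum_O; cbn -[phi]; rewrite !Rmult_1_r.
  replace (0 + 1)%R with 1%R by ring; field.
- rewrite hsum1_rec, same_parity_power_S0, pow_i, !Rmult_0_r, pow_i by lia.
  rewrite Rmult_0_r; field.
Qed.

Lemma cont_at_deriv (b : R) (g g1 : R -> C) :
  (forall y, Icc 0 b y -> is_derive_on (Icc 0 b) g y (g1 y)) ->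
  forall y, Icc 0 b y -> cont_at (Icc 0 b) g y.
Proof. intros H y Hy; exact (is_derive_on_cont _ _ _ _ Hy (H y Hy)). Qed.

Lemma beta_0 (b : R) (f : R -> C) (x : R) :
  (0 < b)%R -> cont_at (Icc 0 b) f 0 -> Icc 0 b x ->
  beta f 0 x = (f x - RtoC 1) / RtoC 2.
Proof.
intros Hb Cf Hx.
transitivity ((f x + - RtoC 1) * / RtoC 2); [|unfold Cdiv; ring].
apply (extend0_eq b _ (fun y => (f y + - RtoC 1) * / RtoC 2)); try easy.
apply cont_at_mult; [apply cont_at_plus; [exact Cf|]|]; apply cont_at_const.
Qed.

Lemma gamma_0 (b : R) (q f f1 : R -> C) (x : R) :
  (0 < b)%R -> continuous_on (U := C_R_NormedModule) (Icc 0 b) q ->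
  (forall y, Icc 0 b y -> is_derive_on (Icc 0 b) f y (f1 y)) ->
  (forall y, Icc 0 b y -> f y <> RtoC 0) ->
  cont_at (Icc 0 b) f1 0 -> Icc 0 b x ->
  gamma b q f 0 x = (f1 x - Derive_on (Icc 0 b) f 0) / RtoC 2 - RtoC (1 / 4) * CInt q 0 x.
Proof.
intros Hb Cq Df Hf Cf1 Hx.
set (h := Derive_on (Icc 0 b) f 0).
transitivity ((f1 x + - h) * / RtoC 2 + - RtoC (1 / 4) * CInt q 0 x); [|unfold Cdiv; ring].
apply (extend0_eq b _ (fun y => (f1 y + - h) * / RtoC 2 + - RtoC (1 / 4) * CInt q 0 y)); try easy.
- intros y Hy; unfold gamma_pos; rewrite csum_O.
  assert (Iy : Icc 0 b y) by (unfold Icc; lra).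
  rewrite (Derive_on_unique b (phi f 0) y (dphi f f1 0 y)); [|lra|exact Iy|now apply phi_deriv].
  fold h; unfold dphi; rewrite same_parity_power_O; cbn [pred].
  simpl INR; simpl pow; cbn [legendre_coef Nat.eqb Cpow].
  replace ((2 * 0 + 1) / 2)%R with (/ 2)%R by field.
  replace (0 * (0 + 1) / (2 * y))%R with 0%R by (field; lra).
  replace (1 / 4)%R with (/ 2 * / 2)%R by field.
  replace (1 / 2)%R with (/ 2)%R by field.
  rewrite RtoC_mult, RtoC_plus, !RtoC_inv by lra.
  field; now apply Hf.
- apply cont_at_plus; apply cont_at_mult; try apply cont_at_const.
  + apply cont_at_plus; [exact Cf1|apply cont_at_const].
  + assert (I0 : Icc 0 b 0) by (unfold Icc; lra).
    apply (is_derive_on_cont _ _ _ (q 0%R) I0).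
    apply is_derive_on_CInt; [exact Cq|exact I0].
Qed.

(** * The case n = 1 and the functions of index -1 *)

Lemma legendre_sum_1 (A : nat -> C) : legendre_sum A 1 = A 1%nat.
Proof. unfold legendre_sum; rewrite csum_S, csum_O; cbn; at_C; ring. Qed.

Lemma sigma_core_1 (f : R -> C) (x : R) : sigma_core f 1 x = phi f 1 x - RtoC x.
Proof. unfold sigma_core, hsum; rewrite legendre_sum_1; cbn -[phi]; rewrite Rmult_1_r; ring. Qed.

Lemma sigma_core1_1 (f f1 : R -> C) (x : R) : sigma_core1 f f1 1 x = dphi f f1 1 x - RtoC 1.
Proof.
unfold sigma_core1, hsum1, hsum; rewrite !legendre_sum_1; cbn -[phi dphi].
rewrite Rmult_0_l, Rmult_1_r; ring.
Qed.

Lemma sigma_core2_1 (q f f1 : R -> C) (x : R) : sigma_core2 q f f1 1 x = q x * phi f 1 x.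
Proof.
unfold sigma_core2, hsum2, hsum1, hsum; rewrite !legendre_sum_1; cbn -[phi dphi].
rewrite !Rmult_0_r, !Rmult_0_l; ring.
Qed.

Lemma tau_defect_1 (f : R -> C) (c : C) (x : R) : tau_defect f c 1 x = RtoC x * c.
Proof.
unfold tau_defect, hsum1; rewrite legendre_sum_1; cbn -[phi].
rewrite !Rmult_0_l, Rmult_0_r, !Rmult_1_r. unfold Rdiv; rewrite !Rmult_0_l; ring.
Qed.

Lemma Derive_on_pos_eq (b : R) (g h : R -> C) (x : R) (l : C) :
  (0 < x <= b)%R -> (forall y, (0 < y <= b)%R -> g y = h y) ->
  is_derive_on (Icc 0 b) h x l ->
  is_derive_on (Icc 0 b) g x l /\ Derive_on (Icc 0 b) g x = l.
Proof.
intros Hx E H.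
assert (Hg : is_derive_on (Icc 0 b) g x l).
{ apply is_derive_on_ext_pos with h; [exact Hx| |exact H].
  intros y Hy; symmetry; now apply E. }
split; [exact Hg|].
apply (Derive_on_unique b); [lra|unfold Icc; lra|exact Hg].
Qed.

Lemma RtoC_neq0 (x : R) : x <> 0%R -> RtoC x <> RtoC 0.
Proof. intros Hx E; now apply Hx, RtoC_inj. Qed.

Lemma sigma_m1 (f : R -> C) (x : R) : sigmaZ f (-1) x = RtoC (/ x) * RtoC (/ 2).
Proof.
unfold sigmaZ, betaZ; change (-1 <? 0)%Z with true; cbv iota.
change (powerRZ x (-1)) with (/ (x * 1))%R; rewrite Rmult_1_r.
replace (1 / 2)%R with (/ 2)%R by field; reflexivity.
Qed.

Lemma tau_m1 (b : R) (q f : R -> C) (x : R) :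
  tauZ b q f (-1) x = RtoC (/ x) * (RtoC (1 / 4) * CInt q 0 x).
Proof.
unfold tauZ, gammaZ; change (-1 <? 0)%Z with true; cbv iota.
change (powerRZ x (-1)) with (/ (x * 1))%R; now rewrite Rmult_1_r.
Qed.

Lemma inv_deriv (b x : R) :
  (0 < x <= b)%R ->
  is_derive_on (Icc 0 b) (fun y => / RtoC y) x (RtoC (- / x ^ 2)).
Proof.
intros Hx; assert (Ix : Icc 0 b x) by (unfold Icc; lra).
assert (Hn := RtoC_neq0 x ltac:(lra)).
assert (H := is_derive_on_inv _ _ _ _ Ix Hn (is_derive_on_RtoC _ x Ix)).
replace (RtoC (- / x ^ 2)) with (- RtoC 1 / (RtoC x * RtoC x)); [exact H|].
rewrite RtoC_opp, RtoC_inv, RtoC_pow by (apply pow_nonzero; lra); simpl; field; exact Hn.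
Qed.

Lemma sigma_m1_deriv (b : R) (f : R -> C) (x : R) :
  (0 < x <= b)%R ->
  is_derive_on (Icc 0 b) (sigmaZ f (-1)) x (RtoC (- / (2 * x ^ 2))) /\
  Derive_on (Icc 0 b) (sigmaZ f (-1)) x = RtoC (- / (2 * x ^ 2)).
Proof.
intros Hx; apply Derive_on_pos_eq with (fun y => RtoC (/ 2) * / RtoC y); [exact Hx| |].
- intros y Hy; rewrite sigma_m1, RtoC_inv by lra; ring.
- replace (- / (2 * x ^ 2))%R with (/ 2 * - / x ^ 2)%R by (field; lra).
  rewrite RtoC_mult; apply is_derive_on_scal; [unfold Icc; lra|now apply inv_deriv].
Qed.

Lemma sigma_m1_deriv2 (b : R) (f : R -> C) (x : R) :
  (0 < x <= b)%R ->
  is_derive_on (Icc 0 b) (Derive_on (Icc 0 b) (sigmaZ f (-1))) x (RtoC (/ x ^ 3)) /\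
  Derive2_on (Icc 0 b) (sigmaZ f (-1)) x = RtoC (/ x ^ 3).
Proof.
intros Hx; assert (Ix : Icc 0 b x) by (unfold Icc; lra).
apply Derive_on_pos_eq with (fun y => RtoC (- / 2) * (/ RtoC y * / RtoC y)); [exact Hx| |].
- intros y Hy; rewrite (proj2 (sigma_m1_deriv b f y Hy)), <- RtoC_inv, <- !RtoC_mult by lra.
  apply f_equal; field; lra.
- assert (I := inv_deriv b x Hx).
  assert (H := is_derive_on_scal _ (RtoC (- / 2)) _ _ _ Ix
                 (is_derive_on_mult _ _ _ _ _ _ Ix I I)).
  match type of H with is_derive_on _ _ _ ?l => replace (RtoC (/ x ^ 3)) with l; [exact H|] end.
  rewrite <- RtoC_inv, <- !RtoC_mult, <- RtoC_plus, <- RtoC_mult by lra.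
  apply f_equal; field; lra.
Qed.

(** * The recurrences *)

Theorem proposition6p1 (b : R) (q f : R -> C)
  (b_pos : (0 < b)%R)
  (q_cont : continuous_on (U := C_R_NormedModule) (Icc 0 b) q)
  (f_sol : is_solution b q f)
  (f_neq0 : forall x : R, Icc 0 b x -> f x <> RtoC 0)
  (f_0 : f 0%R = RtoC 1) :
  let h := Derive_on (Icc 0 b) f 0 in
  let s := sigmaZ f in
  let s' := fun n : Z => Derive_on (Icc 0 b) (sigmaZ f n) in
  let s'' := fun n : Z => Derive2_on (Icc 0 b) (sigmaZ f n) in
  let t := tauZ b q f in
  (* the first functions *)
  (forall x : R, Icc 0 b x ->
     betaZ f (-1) x = RtoC (1 / 2) /\
     betaZ f 0 x = (f x - RtoC 1) / RtoC 2 /\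
     gammaZ b q f (-1) x = RtoC (1 / 4) * CInt q 0 x /\
     gammaZ b q f 0 x =
       (Derive_on (Icc 0 b) f x - h) / RtoC 2 - RtoC (1 / 4) * CInt q 0 x) /\
  (* the derivatives in the relations exist; sigma_{-1} is only considered
     for x > 0 *)
  (forall (n : Z) (x : R), (-1 <= n)%Z -> Icc 0 b x ->
     (0 < x)%R \/ (0 <= n)%Z -> twice_derivable_at (Icc 0 b) (s n) x) /\
  (forall n : Z, (1 <= n)%Z ->
     (* the differential equation on (0,b] *)
     (forall x : R, (0 < x <= b)%R ->
        RtoC (1 / IZR (2 * n + 1)) * (s'' n x - q x * s n x) =
        RtoC (x ^ 2 / IZR (2 * n - 3))
          * (s'' (n - 2)%Z x - q x * s (n - 2)%Z x)
        - RtoC (2 * x)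
          * (s' (n - 2)%Z x - RtoC (IZR (n - 1) / x) * s (n - 2)%Z x)) /\
     (* and at 0, where the factor 2x is multiplied out *)
     ((2 <= n)%Z ->
        RtoC (1 / IZR (2 * n + 1)) * (s'' n 0%R - q 0%R * s n 0%R) =
        RtoC (0 ^ 2 / IZR (2 * n - 3))
          * (s'' (n - 2)%Z 0%R - q 0%R * s (n - 2)%Z 0%R)
        - (RtoC (2 * 0) * s' (n - 2)%Z 0%R
           - RtoC (2 * IZR (n - 1)) * s (n - 2)%Z 0%R)) /\
     (* the initial conditions *)
     s n 0%R = RtoC 0 /\ s' n 0%R = RtoC 0 /\
     (* the relation for tau *)
     (forall x : R, Icc 0 b x -> (0 < x)%R \/ (2 <= n)%Z ->
        t n x =
        s' n x
        + RtoC (IZR (2 * n + 1) / IZR (2 * n - 3) * x ^ 2)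
          * (t (n - 2)%Z x - s' (n - 2)%Z x)
        + RtoC (IZR (2 * n + 1) * x) * s (n - 2)%Z x)).
Proof.
intros h s s' s'' t.
set (f1 := Derive_on (Icc 0 b) f).
assert (Df : forall y, Icc 0 b y -> is_derive_on (Icc 0 b) f y (f1 y)).
{ intros y Hy; destruct (f_sol y Hy) as [[[l Hl] _] _].
  unfold f1; now rewrite (Derive_on_unique b f y l b_pos Hy Hl). }
assert (Df1 : forall y, Icc 0 b y -> is_derive_on (Icc 0 b) f1 y (q y * f y)).
{ intros y Hy; destruct (f_sol y Hy) as [[_ [l Hl]] E].
  unfold Derive2_on in E; rewrite (Derive_on_unique b _ y l b_pos Hy Hl) in E.
  replace (q y * f y) with l; [exact Hl|].
  transitivity (l - q y * f y + q y * f y); [ring|rewrite E; ring]. }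
assert (I0 : Icc 0 b 0) by (unfold Icc; lra).
assert (Cf := cont_at_deriv b f f1 Df).
assert (Cf1 := cont_at_deriv b f1 _ Df1).
assert (B0 := fun x Hx => beta_0 b f x b_pos (Cf 0%R I0) Hx).
assert (B00 : beta f 0 0 = RtoC 0) by (rewrite B0, f_0 by exact I0; unfold Cdiv; ring).
set (c := fun n : nat => ((2 * INR n + 1) / 2)%R).
assert (Sg : forall n x, s (Z.of_nat n) x = RtoC (c n) * sigma_core f n x).
{ intros n x; now apply sigma_eq. }
assert (D1 : forall n x, Icc 0 b x ->
  is_derive_on (Icc 0 b) (s (Z.of_nat n)) x (RtoC (c n) * sigma_core1 f f1 n x)).
{ intros n x Hx; apply is_derive_on_ext with (fun y => RtoC (c n) * sigma_core f n y);
    [exact Hx|intros y _; now rewrite Sg|].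
  apply is_derive_on_scal; [exact Hx|now apply sigma_core_deriv]. }
assert (Sg1 : forall n x, Icc 0 b x -> s' (Z.of_nat n) x = RtoC (c n) * sigma_core1 f f1 n x).
{ intros n x Hx; apply (Derive_on_unique b); auto. }
assert (D2 : forall n x, Icc 0 b x ->
  is_derive_on (Icc 0 b) (s' (Z.of_nat n)) x (RtoC (c n) * sigma_core2 q f f1 n x)).
{ intros n x Hx; apply is_derive_on_ext with (fun y => RtoC (c n) * sigma_core1 f f1 n y);
    [exact Hx|intros y Hy; now rewrite Sg1|].
  apply is_derive_on_scal; [exact Hx|now apply sigma_core1_deriv]. }
assert (Sg2 : forall n x, Icc 0 b x -> s'' (Z.of_nat n) x = RtoC (c n) * sigma_core2 q f f1 n x).
{ intros n x Hx; apply (Derive_on_unique b); [exact b_pos|exact Hx|now apply D2]. }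
assert (half : forall n, (RtoC (1 / (2 * INR n + 1)) * RtoC (c n) = RtoC (/ 2))).
{ intros n; rewrite <- RtoC_mult; apply f_equal; unfold c.
  assert (Hn := pos_INR n); field; lra. }
split; [|split].
- intros x Hx; repeat split.
  + exact (B0 x Hx).
  + exact (gamma_0 b q f f1 x b_pos q_cont Df f_neq0 (Cf1 0%R I0) Hx).
- intros n x Hn Hx Hnx.
  destruct (Z.eq_dec n (-1)) as [->|Hn1].
  + assert (Hx0 : (0 < x <= b)%R) by (unfold Icc in Hx; destruct Hnx; [lra|lia]).
    split; eexists; [apply sigma_m1_deriv|apply sigma_m1_deriv2]; exact Hx0.
  + replace n with (Z.of_nat (Z.to_nat n)) by lia.
    split; eexists; [now apply D1|now apply D2].
- intros n Hn.
  assert (Init : s n 0%R = RtoC 0 /\ s' n 0%R = RtoC 0).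
  { replace n with (Z.of_nat (S (Z.to_nat (n - 1)))) by lia.
    rewrite Sg, Sg1, sigma_core_S0, sigma_core1_S0 by assumption; split; ring. }
  destruct (Z.eq_dec n 1) as [->|Hn1].
  + change (1 - 2)%Z with (-1)%Z; change (1 - 1)%Z with 0%Z.
    split; [|split; [lia|split; [apply Init|split; [apply Init|]]]].
    * intros x Hx; assert (Ix : Icc 0 b x) by (unfold Icc; lra).
      change (s'' 1%Z) with (s'' (Z.of_nat 1)); change (s 1%Z) with (s (Z.of_nat 1)); rewrite Sg2, Sg by exact Ix.
      unfold s'', s', s; rewrite (proj2 (sigma_m1_deriv2 b f x Hx)),
        (proj2 (sigma_m1_deriv b f x Hx)), sigma_m1, sigma_core2_1, sigma_core_1.
      replace (IZR (2 * 1 + 1)) with (2 * INR 1 + 1)%R by (simpl; ring).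
      replace (IZR (2 * 1 - 3)) with (-1)%R by (simpl; ring).
      transitivity (RtoC (1 / (2 * INR 1 + 1)) * RtoC (c 1%nat) * RtoC x * q x); [ring|].
      rewrite half, <- RtoC_mult.
      (* the part without q vanishes, the part with q is q x / 2 *)
      match goal with |- _ = RtoC ?A * (RtoC ?B - q x * (RtoC ?D * RtoC ?E))
                             - RtoC ?F * (RtoC ?G - RtoC ?H * (RtoC ?D * RtoC ?E)) =>
        transitivity (RtoC (A * B - F * (G - H * (D * E))) + RtoC (- (A * (D * E))) * q x);
          [|push_RtoC; ring];
        replace (A * B - F * (G - H * (D * E)))%R with 0%R by (field; lra);
        replace (- (A * (D * E)))%R with (/ 2 * x)%R by (field; lra)
      end; ring.
    * intros x Ix [Hx0|]; [|lia].
      assert (Hx : (0 < x <= b)%R) by (unfold Icc in Ix; lra).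
      change (t 1%Z) with (t (Z.of_nat 1)); change (s' 1%Z) with (s' (Z.of_nat 1)).
      unfold t at 1; rewrite (tau_eq b q f f1 1 x Hx Df f_neq0), Sg1 by exact Ix.
      unfold s', s; rewrite (proj2 (sigma_m1_deriv b f x Hx)), sigma_m1,
        sigma_core1_1, tau_defect_1.
      replace (RtoC (1 + (-1) ^ 1)) with (RtoC 0) by (apply f_equal; simpl; ring).
      replace (IZR (2 * 1 + 1)) with 3%R by (simpl; ring).
      replace (IZR (2 * 1 - 3)) with (-1)%R by (simpl; ring).
      unfold t; rewrite tau_m1; unfold c; simpl INR.
      match goal with |- RtoC ?A * (?y - _ * (RtoC ?B * ?z + _)) =
           _ + RtoC ?D * (RtoC ?E * (RtoC ?F * _) - RtoC ?G) + RtoC ?H * (RtoC ?I * RtoC ?J) =>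
        transitivity (RtoC A * y + RtoC (- (A * x * B)) * z); [push_RtoC; ring|];
        transitivity (RtoC A * y + RtoC (D * E * F) * z + RtoC (H * (I * J) - D * G));
          [|push_RtoC; ring];
        replace (D * E * F)%R with (- (A * x * B))%R by (field; lra);
        replace (H * (I * J) - D * G)%R with 0%R by (field; lra)
      end; ring.
  + set (m := Z.to_nat (n - 2)).
    assert (En : n = Z.of_nat (S (S m))) by (unfold m; lia).
    assert (E1 : IZR (2 * n + 1) = (2 * INR (S (S m)) + 1)%R).
    { rewrite En, plus_IZR, mult_IZR, <- INR_IZR_INZ; reflexivity. }
    assert (E2 : IZR (2 * n - 3) = (2 * INR m + 1)%R).
    { rewrite minus_IZR, mult_IZR, En, <- INR_IZR_INZ, !S_INR; ring. }
    assert (E3 : IZR (n - 1) = INR (S m)).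
    { rewrite minus_IZR, En, <- INR_IZR_INZ, !S_INR; ring. }
    rewrite E1, E2, E3.
    replace (n - 2)%Z with (Z.of_nat m) by lia.
    rewrite En in Init |- *; clear E1 E2 E3 En.
    assert (Hm := pos_INR m).
    assert (Ode : forall x, Icc 0 b x ->
      RtoC (1 / (2 * INR (S (S m)) + 1)) *
        (s'' (Z.of_nat (S (S m))) x - q x * s (Z.of_nat (S (S m))) x) =
      RtoC (x ^ 2 / (2 * INR m + 1)) * (s'' (Z.of_nat m) x - q x * s (Z.of_nat m) x)
      - (RtoC (2 * x) * s' (Z.of_nat m) x - RtoC (2 * INR (S m)) * s (Z.of_nat m) x)).
    { intros x Ix; rewrite !Sg2, !Sg, Sg1 by exact Ix.
      transitivity (RtoC (1 / (2 * INR (S (S m)) + 1)) * RtoC (c (S (S m)))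
        * (sigma_core2 q f f1 (S (S m)) x - q x * sigma_core f (S (S m)) x)); [ring|].
      rewrite half, sigma_core_rec.
      replace (x ^ 2 / (2 * INR m + 1))%R with (x ^ 2 * (1 / (2 * INR m + 1)))%R
        by (field; lra).
      rewrite (RtoC_mult (x ^ 2)).
      match goal with |- _ = ?p * ?d * (?e * ?j2 - ?q * (?e * ?j)) - ?r =>
        transitivity (p * (d * e) * (j2 - q * j) - r); [|ring] end.
      rewrite half; unfold c; unfold Rdiv; push_RtoC.
      replace (RtoC 2) with (/ RtoC (/ 2)) by (rewrite <- RtoC_inv by lra; now rewrite Rinv_inv).
      assert (RtoC (/ 2) <> RtoC 0) by (apply RtoC_neq0; lra).
      field; auto. }
    split; [|split; [|split; [apply Init|split; [apply Init|]]]].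
    * intros x Hx; rewrite Ode by (unfold Icc; lra).
      replace (RtoC (2 * INR (S m))) with (RtoC (2 * x) * RtoC (INR (S m) / x)); [ring|].
      rewrite <- RtoC_mult; apply f_equal; field; lra.
    * intros _; exact (Ode 0%R I0).
    * intros x Ix _.
      destruct (Req_EM_T x 0) as [->|Hx0].
      (* every term that is not zero by the initial conditions has a factor x *)
      { rewrite (proj2 Init); unfold t at 1, tauZ.
        rewrite powerRZ_nat, pow_i, !pow_i, !Rmult_0_r by lia; ring. }
      assert (Hx : (0 < x <= b)%R) by (unfold Icc in Ix; lra).
      unfold t; rewrite !(tau_eq b q f f1 _ x Hx Df f_neq0), !Sg1, !Sg by exact Ix.
      rewrite tau_defect_rec.
      replace ((-1) ^ S (S m))%R with ((-1) ^ m)%R by (simpl; ring).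
      set (C0 := RtoC (1 / 2) * _ + _).
      fold (c m) (c (S (S m))).
      replace (RtoC ((2 * INR (S (S m)) + 1) / (2 * INR m + 1) * x ^ 2))
        with (RtoC (2 * c (S (S m))) * RtoC (1 / (2 * INR m + 1)) * RtoC (x ^ 2)).
      2: { rewrite <- !RtoC_mult; apply f_equal; unfold c; field; lra. }
      match goal with |- _ = _ + ?a * ?d * ?e * (?g * (?j - ?k) - ?g * ?j) + _ * (_ * ?l) =>
        transitivity (RtoC (c (S (S m))) * sigma_core1 f f1 (S (S m)) x
          - a * (d * g) * e * k + RtoC ((2 * INR (S (S m)) + 1) * x) * (g * l)); [|ring] end.
      rewrite half.
      replace (RtoC (2 * c (S (S m))) * RtoC (/ 2)) with (RtoC (c (S (S m)))).
      2: { rewrite <- RtoC_mult; apply f_equal; field. }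
      replace (RtoC ((2 * INR (S (S m)) + 1) * x) * (RtoC (c m) * sigma_core f m x))
        with (RtoC (c (S (S m))) * (RtoC ((2 * INR m + 1) * x) * sigma_core f m x)).
      2: { rewrite !Cmult_assoc, <- !RtoC_mult; do 2 f_equal; unfold c; field. }
      ring.
Qed.
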